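(* The problem: find $u_h\in V_{\mathcal P}$ such that $$a_J(u_h^+,v_h)+s(u_h^-,v_h)=\langle f,v_h\rangle_\Omega\qquad\forall\, v_h\in V_{\mathcal P},$$ has a unique solution.
   Context: $\Omega\subset\mathbb R^d$ ($d=2,3$) is an open bounded Lipschitz domain with polyhedral boundary. $f\in H^{-1}(\Omega)$, and $\langle\cdot,\cdot\rangle_\Omega$ is the duality pairing between $H^{-1}(\Omega)$ and $H^1_0(\Omega)$; $(\cdot,\cdot)_\Omega$ is the $L^2(\Omega)$ inner product. $\mathcal D=(d_{ij})\in L^\infty(\Omega)^{d\times d}$ is symmetric and there is $d_0>0$ with $\sum_{i,j}y_i d_{ij}(\boldsymbol x)y_j\ge d_0\sum_i y_i^2$ for all $y\in\mathbb R^d$ and a.e. $\boldsymbol x\in\Omega$. $\boldsymbol\beta\in L^\infty(\Omega)^d$ with $\mathrm{div}\,\boldsymbol\beta=0$, $\mu>0$ and $\kappa>0$ are constants. $a(w,v)=(\mathcal D\nabla w,\nabla v)_\Omega+(\boldsymbol\beta\cdot\nabla w,v)_\Omega+(\mu w,v)_\Omega$. $\|\cdot\|_{0,\infty,G}$ is the $L^\infty(G)$ norm. $\boldsymbol\beta$ is understood to be regular enough that its restrictions to facets, and hence $\|\boldsymbol\beta\|_{0,\infty,F}$, make sense, with $\|\boldsymbol\beta\|_{0,\infty,F}\le\|\boldsymbol\beta\|_{0,\infty,K}$ when $F$ is a facet of $K$. Mesh and spaces. $\mathcal P$ is a conforming, shape-regular, quasi-uniform partition of $\Omega$ into closed simplices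 (or affine quadrilaterals/hexahedra); $h_G$ is the diameter of $G$. For $k\ge1$, $V_{\mathcal P}=\{v_h\in C^0(\overline\Omega): v_h|_K\in\mathfrak R(K)\ \forall K\in\mathcal P\}\cap H^1_0(\Omega)$, where $\mathfrak R(K)=\mathbb P_k(K)$ (polynomials of total degree $\le k$) if $K$ is a simplex and $\mathfrak R(K)=\mathbb Q_k(K)$ (mapped polynomials of degree $\le k$ in each variable) if $K$ is an affine quadrilateral/hexahedron. $\boldsymbol x_1,\dots,\boldsymbol x_N$ are the internal Lagrange nodes, $\phi_1,\dots,\phi_N$ the corresponding Lagrange basis of $V_{\mathcal P}$, and $\omega_i=\bigcup\{K\in\mathcal P:\boldsymbol x_i\in K\}$. $\mathcal F_I$ is the set of internal facets, $\llbracket\cdot\rrbracket$ the jump across a facet. The mesh function $\mathfrak h$ is the continuous elementwise linear function (multilinear on quadrilaterals/hexahedra) whose value at each mesh vertex $\boldsymbol v$ is the arithmetic mean of $h_K$ over the elements $K\ni\boldsymbol v$. Projection. For $v_h\in V_{\mathcal P}$, $v_h^+=\sum_{i=1}^N\max\{0,\min\{v_h(\boldsymbol x_i),\kappa\}\}\phi_i$ and $v_h^-=v_h-v_h^+$. Forms. With a fixed constant $\gamma\ge0$, $J(u_h,v_h)=\gamma\sum_{F\in\mathcal F_I}\int_F\|\boldsymbol\beta\|_{0,\infty,F}h_F^2\,\llbracket\nabla u_h\rrbracket\cdot\llbracket\nabla v_h\rrbracket\,ds$ and $a_J(u_h,v_h)=a(u_h,v_h)+J(u_h,v_h)$. With a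 constant $\alpha>0$, $$s(v_h,w_h)=\alpha\sum_{i=1}^N\left(\|\mathcal D\|_{0,\infty,\omega_i}\mathfrak h(\boldsymbol x_i)^{d-2}+\|\boldsymbol\beta\|_{0,\infty,\omega_i}\mathfrak h(\boldsymbol x_i)^{d-1}+\mu\,\mathfrak h(\boldsymbol x_i)^d\right)v_h(\boldsymbol x_i)w_h(\boldsymbol x_i).$$ *)

(* Defs.v *)
From HB Require Import structures.
From mathcomp Require Import all_boot all_order all_algebra.
From mathcomp Require Import all_classical all_reals all_analysis.
Set Implicit Arguments.
Unset Strict Implicit.
Unset Printing Implicit Defensive.
Import Order.TTheory GRing.Theory Num.Theory.
Import numFieldNormedType.Exports.
Local Open Scope classical_set_scope.
Local Open Scope ring_scope.

Section measurable_rV.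
Context {R : realType}.
Variable n : nat.

(* The product sigma-algebra, generated by the coordinates: this is the Borel
   sigma-algebra of R^n. *)
Let coord : 'I_n -> 'rV[R]_n -> measurableTypeR R := fun i x => x ord0 i.

Let rV_set0 : g_sigma_preimage coord set0.
Proof. exact: sigma_algebra0. Qed.

Let rV_setC A : g_sigma_preimage coord A -> g_sigma_preimage coord (~` A).
Proof. exact: sigma_algebraC. Qed.

Let rV_bigcup (F : _^nat) : (forall i, g_sigma_preimage coord (F i)) ->
  g_sigma_preimage coord (\bigcup_i (F i)).
Proof. exact: sigma_algebra_bigcup. Qed.

HB.instance Definition _ := @isMeasurable.Build default_measure_display
  'rV[R]_n (g_sigma_preimage coord) rV_set0 rV_setC rV_bigcup.

Lemma measurable_coord (i : 'I_n) :
  measurable_fun [set: 'rV[R]_n] (fun x => x ord0 i : measurableTypeR R).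
Proof.
move=> _ Y mY; rewrite setTI; apply: sub_sigma_algebra => /=.
rewrite -bigcup_seq/=; exists i => /=; first by rewrite mem_index_enum.
by exists Y => //; rewrite setTI.
Qed.

Lemma measurable_fun_rV d (T : measurableType d) (f : T -> 'rV[R]_n) :
  (forall i, measurable_fun setT (fun t => f t ord0 i : measurableTypeR R)) ->
  measurable_fun setT f.
Proof.
move=> mf; have fS : g_sigma_preimage (fun i => coord i \o f) `<=` measurable.
  apply: smallest_sub; first exact: sigma_algebra_measurable.
  move=> A; rewrite -bigcup_seq => -[i /= _] [B mB <-].
  exact: mf.
move=> _ A mA; apply: fS; rewrite g_sigma_preimage_comp.
by exists A.
Qed.

End measurable_rV.

Section lebesgue_rV.
Context {R : realType}.

Definition cons_rV n (p : measurableTypeR R * 'rV[R]_n) : 'rV[R]_n.+1 :=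
  \row_j (if unlift ord0 j is Some i then p.2 ord0 i else p.1).

Definition uncons_rV n (x : 'rV[R]_n.+1) : measurableTypeR R * 'rV[R]_n :=
  (x ord0 ord0, \row_i x ord0 (lift ord0 i)).

Lemma cons_rVK n : cancel (@cons_rV n) (@uncons_rV n).
Proof.
case=> a x; rewrite /uncons_rV !mxE unlift_none; congr pair.
by apply/rowP => i; rewrite !mxE liftK.
Qed.

Lemma measurable_cons_rV n : measurable_fun setT (@cons_rV n).
Proof.
apply: measurable_fun_rV => i.
case: (unliftP ord0 i) => [j ->|->].
  rewrite (_ : (fun _ => _) = (fun x : 'rV[R]_n => x ord0 j) \o snd).
    exact: (measurableT_comp (measurable_coord j)).
  by apply/funext => p /=; rewrite mxE liftK.
rewrite (_ : (fun _ => _) = fst) //.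
by apply/funext => p; rewrite mxE unlift_none.
Qed.

Lemma measurable_uncons_rV n : measurable_fun setT (@uncons_rV n).
Proof.
apply/measurable_fun_pairP; split; first exact: measurable_coord.
apply: measurable_fun_rV => i.
rewrite (_ : (fun _ => _) = (fun x : 'rV[R]_n.+1 => x ord0 (lift ord0 i))).
  exact: measurable_coord.
by apply/funext => x /=; rewrite mxE.
Qed.

Section succ.
Variables (n : nat) (mu : {sigma_finite_measure set 'rV[R]_n -> \bar R}).

Definition lebesgue_succ : set 'rV[R]_n.+1 -> \bar R :=
  pushforward (lebesgue_measure \x mu)%E (@cons_rV n).

HB.instance Definition _ := Measure.copy lebesgue_succ
  (measure_function_pushforward__canonical__measure_function_Measure
     (lebesgue_measure \x mu)%E (@measurable_cons_rV n)).

Lemma lebesgue_succ_sigma_finite : sigma_finite setT lebesgue_succ.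
Proof.
have /sigma_finiteP[F [TF ndF Foo]] := sigma_finiteT (@lebesgue_measure R).
have /sigma_finiteP[G [TG ndG Goo]] := sigma_finiteT mu.
exists (fun i => @uncons_rV n @^-1` (F i `*` G i)).
  apply/seteqP; split => // x _; have [/= i _ Fi] : (\bigcup_i F i) (uncons_rV x).1.
    by rewrite -TF.
  have [j _ Gj] : (\bigcup_i G i) (uncons_rV x).2 by rewrite -TG.
  exists (maxn i j) => //; split.
  - by move: Fi; exact/subsetPset/ndF/leq_maxl.
  - by move: Gj; exact/subsetPset/ndG/leq_maxr.
move=> i; have [mF Fi] := Foo i; have [mG Gi] := Goo i; split.
  rewrite -[X in measurable X]setTI; apply: measurable_uncons_rV => //.
  exact: measurableX.
rewrite /lebesgue_succ /pushforward -comp_preimage.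
rewrite (_ : _ \o _ = id); last by apply/funext => p; exact: cons_rVK.
rewrite preimage_id product_measure1E// lte_mul_pinfty// ge0_fin_numE//.
Qed.

HB.instance Definition _ := Measure_isSigmaFinite.Build _ _ _ lebesgue_succ
  lebesgue_succ_sigma_finite.
End succ.

(* Iterated product of the one-dimensional Lebesgue measure. *)
Fixpoint lebesgue_rV n : {sigma_finite_measure set 'rV[R]_n -> \bar R} :=
  if n is m.+1 then lebesgue_succ (lebesgue_rV m) else \d_(0 : 'rV[R]_0).
End lebesgue_rV.

Section euclid.
Context {R : realType}.

Definition dot n (x y : 'rV[R]_n) : R := \sum_j x ord0 j * y ord0 j.

(* Euclidean norm of a vector, Frobenius norm of a matrix. *)
Definition enorm m n (A : 'M[R]_(m, n)) : R :=
  Num.sqrt (\sum_i \sum_j A i j ^+ 2).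

Definition eball n (x : 'rV[R]_n) (r : R) : set 'rV[R]_n :=
  [set y | enorm (y - x) < r].

Definition diam n (G : set 'rV[R]_n) : R :=
  sup [set enorm (p.1 - p.2) | p in G `*` G].

Definition conv n (s : seq 'rV[R]_n) : set 'rV[R]_n :=
  [set x | exists w : 'I_(size s) -> R,
     [/\ forall i, 0 <= w i, \sum_i w i = 1 & x = \sum_i w i *: s`_i]].

End euclid.

Section domain.
Context {R : realType} {d : nat}.
Implicit Types Om : set 'rV[R]_d.

(* Near every boundary point, and in a suitable orthonormal frame with last
   vector e, the set is the strict epigraph of a Lipschitz function g of the
   remaining coordinates, i.e. of the component of x orthogonal to e. *)
Definition lipschitz_boundary Om : Prop :=
  forall p, (closure Om `\` Om) p ->
  exists (r : R) (e : 'rV[R]_d) (g : 'rV[R]_d -> R) (L : R),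
    [/\ 0 < r, enorm e = 1,
        forall x y, `|g x - g y| <= L * enorm (x - y) &
        forall x, eball p r x -> (Om x <-> g (x - dot x e *: e) < dot x e)].

Definition polyhedral_boundary Om : Prop :=
  exists faces : seq (seq 'rV[R]_d),
    (forall s, s \in faces -> exists (nu : 'rV[R]_d) (c : R),
       nu != 0 /\ forall p, p \in s -> dot p nu = c) /\
    closure Om `\` Om = \bigcup_(s in [set` faces]) conv s.

Definition polyhedral_lipschitz_domain Om : Prop :=
  [/\ open Om, connected Om, bounded_set Om,
      lipschitz_boundary Om & polyhedral_boundary Om].

End domain.

Section spaces.
Context {R : realType} {d : nat}.
Notation vec := 'rV[R]_d.
Notation mu := (@lebesgue_rV R d).
Variable Om : set vec.

Definition partial (j : 'I_d) (f : vec -> R) : vec -> R :=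
  fun x => 'D_(delta_mx ord0 j) f x.

Definition gradient (f : vec -> R) : vec -> vec :=
  fun x => \row_j partial j f x.

Fixpoint Ck (n : nat) (f : vec -> R) : Prop :=
  continuous f /\
  if n is m.+1 then
    forall j, (forall x, derivable f x (delta_mx ord0 j)) /\ Ck m (partial j f)
  else True.

Definition test_function (phi : vec -> R) : Prop :=
  [/\ forall n, Ck n phi, compact (closure [set x | phi x != 0])
    & closure [set x | phi x != 0] `<=` Om].

Definition L2 (u : vec -> R) : Prop :=
  measurable_fun Om u /\ mu.-integrable Om (fun x => (u x ^+ 2)%:E).

Definition Linf_norm (G : set vec) (g : vec -> R) : \bar R :=
  'N[mu]_+oo [ EFin \o (g \_ G) ]%E.

Definition Linf (u : vec -> R) : Prop :=
  measurable_fun Om u /\ (Linf_norm Om u < +oo)%E.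

Definition is_weak_gradient (v : vec -> R) (g : vec -> vec) : Prop :=
  (forall j, L2 (fun x => g x ord0 j)) /\
  forall phi, test_function phi -> forall j,
    \int[mu]_(x in Om) (v x * partial j phi x) =
    - \int[mu]_(x in Om) (g x ord0 j * phi x).

Definition H1 (v : vec -> R) : Prop :=
  L2 v /\ exists g, is_weak_gradient v g.

(* The gradient of a function of H1; it is determined up to null sets. *)
Definition wgrad (v : vec -> R) : vec -> vec :=
  xget (cst 0) [set g | is_weak_gradient v g].

Definition H1_norm (v : vec -> R) : R :=
  Num.sqrt (\int[mu]_(x in Om) (v x ^+ 2) +
            \int[mu]_(x in Om) (enorm (wgrad v x) ^+ 2)).

(* The closure of the test functions in H1; the weak gradient of phi n is its
   classical gradient. *)
Definition H10 (v : vec -> R) : Prop :=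
  H1 v /\ exists2 phi : nat -> vec -> R, forall n, test_function (phi n) &
    (fun n => \int[mu]_(x in Om) ((phi n x - v x) ^+ 2) +
       \int[mu]_(x in Om) (enorm (gradient (phi n) x - wgrad v x) ^+ 2))
      @ \oo --> (0 : R).

(* Bounded linear functionals on H10, functions being identified when they
   agree a.e. in Om: invariance of f follows from the bound. *)
Definition Hm1 (f : (vec -> R) -> R) : Prop :=
  (forall (c : R) v w, H10 v -> H10 w -> f (c *: v + w) = c * f v + f w) /\
  exists C : R, forall v, H10 v -> `|f v| <= C * H1_norm v.

Definition divergence_free (b : vec -> vec) : Prop :=
  forall phi, test_function phi ->
    \int[mu]_(x in Om) dot (b x) (gradient phi x) = 0.

End spaces.

Section cells.
Context {R : realType} {d : nat}.
Notation vec := 'rV[R]_d.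

(* The image of the reference simplex (if [simplicial]) or of the reference
   cube [0,1]^d under the affine map y |-> origin + y *m frame. *)
Record cell := Cell { simplicial : bool; origin : vec; frame : 'M[R]_d }.

Definition ref_cell (b : bool) : set vec :=
  if b then [set y | (forall j, 0 <= y ord0 j) /\ \sum_j y ord0 j <= 1]
  else [set y | forall j, 0 <= y ord0 j <= 1].

Definition cell_map (K : cell) (y : vec) : vec := origin K + y *m frame K.

Definition carrier (K : cell) : set vec :=
  cell_map K @` ref_cell (simplicial K).

Definition ref_facets (b : bool) : set (set vec) :=
  [set F | (exists j : 'I_d, F = [set y | ref_cell b y /\ y ord0 j = 0]) \/
    if b then F = [set y | ref_cell b y /\ \sum_j y ord0 j = 1]
    else exists j : 'I_d, F = [set y | ref_cell b y /\ y ord0 j = 1]].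

Definition facets (K : cell) : set (set vec) :=
  [set cell_map K @` F | F in ref_facets (simplicial K)].

(* Faces of all dimensions are the intersections of facets. *)
Definition faces (K : cell) : set (set vec) :=
  [set carrier K `&` \bigcap_(F in A) F | A in [set A | A `<=` facets K]].

(* Principal lattice of order k; the vertices are the nodes of order 1. *)
Definition lagrange_nodes (k : nat) (K : cell) : set vec :=
  [set cell_map K y | y in [set y | ref_cell (simplicial K) y /\
     forall j, exists m : nat, y ord0 j = m%:R / k%:R]].

Definition vertices (K : cell) : set vec := lagrange_nodes 1 K.

Definition monomial k (a : {ffun 'I_d -> 'I_k.+1}) (x : vec) : R :=
  \prod_j x ord0 j ^+ a j.

Definition Pk (k : nat) : set (vec -> R) :=
  [set p | exists c : {ffun 'I_d -> 'I_k.+1} -> R, forall x,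
     p x = \sum_(a : {ffun 'I_d -> 'I_k.+1} | (\sum_j a j <= k)%N)
             c a * monomial a x].

Definition Qk (k : nat) : set (vec -> R) :=
  [set p | exists c : {ffun 'I_d -> 'I_k.+1} -> R, forall x,
     p x = \sum_(a : {ffun 'I_d -> 'I_k.+1}) c a * monomial a x].

(* On a parallelotope the polynomials are those of the reference coordinates. *)
Definition local_space (k : nat) (K : cell) : set (vec -> R) :=
  if simplicial K then Pk k else [set p : vec -> R | Qk k (p \o cell_map K)].

End cells.
Arguments cell R d : clear implicits.

Section mesh.
Context {R : realType} {d m : nat}.
Notation vec := 'rV[R]_d.
Variables (Om : set vec) (K : 'I_m -> cell R d).

Definition conforming_partition : Prop :=
  [/\ forall i, frame (K i) \in unitmx,
      closure Om = \bigcup_i carrier (K i),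
      forall i j, i != j ->
        (carrier (K i))° `&` (carrier (K j))° = set0 &
      forall i j, i != j ->
        let G := carrier (K i) `&` carrier (K j) in
        G = set0 \/ (faces (K i) G /\ faces (K j) G)].

Definition shape_regular (sigma : R) : Prop :=
  forall i, exists (c : vec) (r : R),
    [/\ 0 < r, eball c r `<=` carrier (K i) & diam (carrier (K i)) <= sigma * r].

Definition quasi_uniform (rho : R) : Prop :=
  forall i j, diam (carrier (K i)) <= rho * diam (carrier (K j)).

(* Elements of C^0(closure Om) are represented by their extension by zero, so
   that equality of functions of the space is equality on closure Om. *)
Definition VP (k : nat) : set (vec -> R) :=
  [set v | [/\ {within closure Om, continuous v},
               forall x, ~ closure Om x -> v x = 0,
               forall i, exists2 p, local_space k (K i) p &
                 {in carrier (K i), v =1 p} &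
               H10 Om v]].

Definition internal_nodes (k : nat) : set vec :=
  [set x | Om x /\ exists i, lagrange_nodes k (K i) x].

Definition is_node_enumeration (k N : nat) (x : 'I_N -> vec) : Prop :=
  injective x /\ range x = internal_nodes k.

(* Linear independence of phi follows from the second condition. *)
Definition is_lagrange_basis (k N : nat) (x : 'I_N -> vec)
    (phi : 'I_N -> vec -> R) : Prop :=
  [/\ forall i, VP k (phi i), forall i j, phi i (x j) = (i == j)%:R &
      forall v, VP k v -> exists c : 'I_N -> R, v = \sum_i c i *: phi i].

Definition node_patch (x : vec) : set vec :=
  \bigcup_(i in [set i | carrier (K i) x]) carrier (K i).

(* The conditions determine h on closure Om. *)
Definition is_mesh_function (h : vec -> R) : Prop :=
  [/\ {within closure Om, continuous h},
      forall i, exists2 p, local_space 1 (K i) p &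
        {in carrier (K i), h =1 p} &
      forall i v, vertices (K i) v ->
        h v = (\sum_(j < m | v \in carrier (K j)) diam (carrier (K j))) /
              #|[pred j : 'I_m | v \in carrier (K j)]|%:R].

End mesh.

Section facet_integration.
Context {R : realType} {d : nat}.
Notation vec := 'rV[R]_d.
Notation lam := (@lebesgue_rV R d.-1).

(* An affine parametrization y |-> p + y *m B of the hyperplane carrying F; the
   surface integral and the essential supremum below do not depend on it. *)
Definition is_chart (F : set vec) (c : vec * 'M[R]_(d.-1, d)) : Prop :=
  row_free c.2 /\ F `<=` range (fun y => c.1 + y *m c.2).

Definition chart (F : set vec) : vec * 'M[R]_(d.-1, d) :=
  xget (0, 0) [set c | is_chart F c].

Definition chart_map (F : set vec) (y : 'rV[R]_d.-1) : vec :=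
  (chart F).1 + y *m (chart F).2.

Definition facet_integral (F : set vec) (g : vec -> R) : R :=
  Num.sqrt (\det ((chart F).2 *m (chart F).2^T)) *
  \int[lam]_(y in chart_map F @^-1` F) g (chart_map F y).

Definition facet_measurable (F : set vec) (g : vec -> R) : Prop :=
  measurable_fun (chart_map F @^-1` F) (g \o chart_map F).

Definition facet_Linf_norm (F : set vec) (g : vec -> R) : \bar R :=
  'N[lam]_+oo [ EFin \o ((g \_ F) \o chart_map F) ]%E.

(* Trace at x of the gradient of v, taken from inside K. *)
Definition gradient_trace (K : cell R d) (v : vec -> R) (x : vec) : vec :=
  lim (gradient v @ within (carrier K)° (nbhs x)).

Definition gradient_jump (K K' : cell R d) (v : vec -> R) (x : vec) : vec :=
  gradient_trace K v x - gradient_trace K' v x.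

End facet_integration.

Section forms.
Context {R : realType} {d m N : nat}.
Notation vec := 'rV[R]_d.
Notation mu := (@lebesgue_rV R d).
Variables (Om : set vec) (K : 'I_m -> cell R d).
Variables (D : vec -> 'M[R]_d) (b : vec -> vec) (reac : R).

Definition diffusion_tensor (d0 : R) : Prop :=
  [/\ forall i j, Linf Om (fun x => D x i j),
      {ae mu, forall x, Om x -> (D x)^T = D x} &
      {ae mu, forall x, Om x ->
        forall y : vec, d0 * \sum_i y ord0 i ^+ 2 <=
          \sum_i \sum_j y ord0 i * D x i j * y ord0 j}].

Definition convection_field : Prop :=
  (forall j, Linf Om (fun x => b x ord0 j)) /\ divergence_free Om b.

(* The restrictions of b to the facets make sense and are controlled by its
   values in the adjacent cells. *)
Definition facet_regular : Prop :=
  forall i F, facets (K i) F ->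
    (forall j, facet_measurable F (fun x => b x ord0 j)) /\
    (facet_Linf_norm F (fun x => enorm (b x)) <=
     Linf_norm (carrier (K i)) (fun x => enorm (b x)))%E.

Definition form_a (w v : vec -> R) : R :=
  \int[mu]_(x in Om) dot (wgrad Om w x *m (D x)^T) (wgrad Om v x) +
  \int[mu]_(x in Om) (dot (b x) (wgrad Om w x) * v x) +
  \int[mu]_(x in Om) (reac * w x * v x).

(* Each internal facet is the intersection of exactly two cells, so that F runs
   over the internal facets, each being met once; the orientation of the jump
   is immaterial since it occurs twice. *)
Definition form_J (gamma : R) (u v : vec -> R) : R :=
  gamma * \sum_(i < m) \sum_(j < m | (i < j)%N &&
      `[< let F := carrier (K i) `&` carrier (K j) in
          facets (K i) F /\ facets (K j) F >])
    let F := carrier (K i) `&` carrier (K j) in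
    facet_integral F (fun x =>
      fine (facet_Linf_norm F (fun y => enorm (b y))) * diam F ^+ 2 *
      dot (gradient_jump (K i) (K j) u x) (gradient_jump (K i) (K j) v x)).

Definition form_aJ (gamma : R) (u v : vec -> R) : R :=
  form_a u v + form_J gamma u v.

Variables (x : 'I_N -> vec) (phi : 'I_N -> vec -> R) (h : vec -> R).

Definition form_s (alpha : R) (v w : vec -> R) : R :=
  alpha * \sum_i
    (fine (Linf_norm (node_patch K (x i)) (fun y => enorm (D y))) * h (x i) ^+ (d - 2)
     + fine (Linf_norm (node_patch K (x i)) (fun y => enorm (b y))) * h (x i) ^+ (d - 1)
     + reac * h (x i) ^+ d) * v (x i) * w (x i).

Definition pos_part (kappa : R) (v : vec -> R) : vec -> R :=
  \sum_i Num.max 0 (Num.min (v (x i)) kappa) *: phi i.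

Definition neg_part (kappa : R) (v : vec -> R) : vec -> R :=
  v - pos_part kappa v.

End forms.

(* Main.v *)
(** In nodal coordinates [u_i = u(x_i)] the problem reads
    [A cl(u) + S (u - cl(u)) = F], where [A] is the matrix of [a_J], [S] is
    diagonal with positive entries and [cl] truncates each coordinate to
    [[0, kappa]].  Both [A] and [S] are positive definite: the convection term
    of [a_J(v, v)] vanishes because [beta] is divergence free (apply this to the
    squares of test functions approximating [v]), diffusion and jumps are
    nonnegative, the reaction term is positive; and the mesh function is
    positive, being on each cell a convex combination of its vertex values.

    Uniqueness follows since [u |-> u - cl(u)] is monotone with respect to
    [cl(u)].  For existence, [w = cl(u)] solves a variational inequality on the
    box [[0, kappa]^N], i.e. is a fixed point of
    [w |-> cl(w + t S^-1 (F - A w))] for any [t > 0].  For small [t] this map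
    strictly decreases distances in the [S]-norm, so it fixes any point of the
    compact box that minimizes the displacement; then [u = w + S^-1 (F - A w)].

    Weak gradients are only chosen up to null sets, so bilinearity of [a_J]
    rests on the fundamental lemma of the calculus of variations, proved with
    smooth bumps [exp(-1/t)] approximating indicators of boxes. *)
Require Import Defs.
From mathcomp Require Import all_boot all_order all_algebra.
From mathcomp Require Import all_classical all_reals all_analysis.
From mathcomp Require Import measurable_realfun ess_sup_inf.
From mathcomp Require Import ring lra zify.
Set Implicit Arguments.
Unset Strict Implicit.
Unset Printing Implicit Defensive.
Import Order.TTheory GRing.Theory Num.Theory.
Import numFieldNormedType.Exports.
Local Open Scope classical_set_scope.
Local Open Scope ring_scope.

(** Convection makes [A] nonsymmetric in general, so the truncated problem is not the minimization
    of an energy over the box; a projection iteration takes the place of a variational argument. In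
    |e - t S^-1 A e|_S^2 = |e|_S^2 - 2 t e.Ae + t^2 |S^-1 A e|_S^2 the weights cancel from the cross
    term, whose sign is then the positivity of [A]; this is why distances are measured in the norm
    of [S]. The relation w = cl(u) says that u - w lies in the normal cone of the box at w. Cones
    are invariant under positive scaling, so [t] can be taken as small as the contraction requires
    and dropped at the end.

    Strict positivity of [A] is read off from the reaction term: a nonzero value at a node of the
    open set [Om] persists nearby by continuity, so the L2 norm is positive. The jump form is
    tractable because every point of a closed cell is a limit of interior points, which identifies
    the trace of the gradient with the gradient of the local polynomial. *)

Section boxes.
Context {R : realType} {n : nat}.
Notation vec := 'rV[R]_n.
Implicit Types (a b x : vec) (U : set vec).

(** * Boxes and the topology and sigma-algebra of R^n *)

Definition open_box a b : set vec :=
  [set x | forall i, a ord0 i < x ord0 i < b ord0 i].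

Definition closed_box a b : set vec :=
  [set x | forall i, a ord0 i <= x ord0 i <= b ord0 i].

Lemma open_boxW a b : open_box a b `<=` closed_box a b.
Proof. by move=> x xab i; have /andP[/ltW -> /ltW ->] := xab i. Qed.

Lemma closed_closed_box a b : closed (closed_box a b).
Proof.
rewrite (_ : closed_box a b = \bigcap_(i in [set: 'I_n])
  ((fun x : vec => x ord0 i) @^-1` `[a ord0 i, b ord0 i])).
  apply: closed_bigI => i _; apply: closed_comp; last exact: itv_closed.
  by move=> x _; exact: coord_continuous.
apply/seteqP; split => x /= xab i; first by move=> _ /=; rewrite in_itv /=.
by have := xab i I; rewrite /= in_itv /=.
Qed.

Lemma ball_rVP x (e : R) y : 0 < e ->
  ball x e y <-> forall i, `|x ord0 i - y ord0 i| < e.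
Proof.
move=> e0; split=> [[_ xy] i|xy]; first exact: xy.
by split=> // i j; rewrite ord1; exact: xy.
Qed.

(** Rational corners keep the family of boxes countable. The closed box is required inside [U] so
    that a bump living on it has compact support in [U]. *)
Lemma open_box_nbhs U x : open U -> U x ->
  exists ab : 'rV[rat]_n * 'rV[rat]_n,
    let a := map_mx ratr ab.1 in let b := map_mx ratr ab.2 in
    open_box a b x /\ closed_box a b `<=` U.
Proof.
move=> oU Ux; have /nbhs_ballP[e /= e0 eU] := open_nbhs_nbhs (conj oU Ux).
have a' i : {q : rat | x ord0 i - e / 2 < ratr q < x ord0 i}.
  apply/cid; have [|q /[!in_itv]] := @rat_in_itvoo _ (x ord0 i - e / 2) (x ord0 i).
    by rewrite ltrBlDr ltrDl divr_gt0.
  by move=> /= ?; exists q.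
have b' i : {q : rat | x ord0 i < ratr q < x ord0 i + e / 2}.
  apply/cid; have [|q /[!in_itv]] := @rat_in_itvoo _ (x ord0 i) (x ord0 i + e / 2).
    by rewrite ltrDl divr_gt0.
  by move=> /= ?; exists q.
exists (\row_i sval (a' i), \row_i sval (b' i)) => /=; split=> [i|y yab].
  by rewrite !mxE; case: (a' i) => p /= /andP[_ ->]; case: (b' i) => q /= /andP[].
apply: eU; apply/ball_rVP => // i; have := yab i; rewrite !mxE.
case: (a' i) => p /= /andP[xp px]; case: (b' i) => q /= /andP[xq qx].
move=> /andP[py yq]; rewrite ltr_norml; apply/andP; split.
  rewrite ltrBrDl ltrBlDr (le_lt_trans yq)// (lt_trans qx)// ltrD2l.
  by rewrite ltr_pdivrMr// ltr_pMr// ltr1n.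
rewrite ltrBlDr -ltrBlDl (lt_le_trans _ py)// (le_lt_trans _ xp)//.
by rewrite lerD2l lerN2 ler_pdivrMr// ler_pMr// ler1n.
Qed.

Lemma open_box_cover U : open U ->
  U = \bigcup_(ab in [set ab : 'rV[rat]_n * 'rV[rat]_n |
        closed_box (map_mx ratr ab.1) (map_mx ratr ab.2) `<=` U])
      open_box (map_mx ratr ab.1) (map_mx ratr ab.2).
Proof.
move=> oU; apply/seteqP; split=> [x Ux|x [ab /= abU /open_boxW]]; last exact: abU.
by have [ab [xab abU]] := open_box_nbhs oU Ux; exists ab.
Qed.

Lemma measurable_coord_preimage (I : 'I_n -> set (measurableTypeR R)) :
  (forall i, measurable (I i)) -> measurable [set x : vec | forall i, I i (x ord0 i)].
Proof.
move=> mI; rewrite (_ : mkset _ = \bigcap_(i in [set: 'I_n])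
  ((fun x : vec => x ord0 i) @^-1` I i)); last first.
  by apply/seteqP; split => x /= xI i; [move=> _|]; exact: xI.
apply: fin_bigcap_measurable => // i _; rewrite -[X in measurable X]setTI.
exact: measurable_coord.
Qed.

Lemma measurable_open_box a b : measurable (open_box a b).
Proof.
rewrite (_ : open_box a b =
  [set x : vec | forall i, `]a ord0 i, b ord0 i[%classic (x ord0 i)]).
  apply: (@measurable_coord_preimage (fun i => `]a ord0 i, b ord0 i[%classic)) => i.
  exact: measurable_itv.
by apply/seteqP; split => x /= xab i; have := xab i; rewrite /= in_itv.
Qed.

Lemma ler_coord_norm x i : `|x ord0 i| <= `|x|.
Proof.
rewrite [leRHS]/Num.norm /= mx_normrE; apply/bigmax_geP; right => /=.
by exists (ord0, i).
Qed.

(** The sigma-algebra is generated by the coordinates; an open set belongs to it as a countable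
    union of rational boxes. *)
Lemma measurable_open_rV U : open U -> measurable U.
Proof.
move=> /open_box_cover ->; rewrite bigcup_mkcond.
apply: countable_bigcupT_measurable => // ab.
by case: ifPn => // _; exact: measurable_open_box.
Qed.

Lemma measurable_closed_rV U : closed U -> measurable U.
Proof.
move=> cU; rewrite -[U]setCK; apply: measurableC; apply: measurable_open_rV.
exact: closed_openC.
Qed.

Lemma continuous_measurable_rV U (f : vec -> R) : measurable U ->
  continuous f -> measurable_fun U f.
Proof.
move=> mU cf; apply: (measurability _ (RGenOpens.measurableE R)) => _ [_ [a [b ->]] <-].
apply: measurableI => //; apply: measurable_open_rV; exact: open_comp.
Qed.

Lemma bounded_sub_closed_box U : bounded_set U ->
  exists M : R, U `<=` closed_box (const_mx (- M)) (const_mx M).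
Proof.
move=> [M [_ UM]]; exists (M + 1) => x Ux i; rewrite !mxE -ler_norml.
apply: (le_trans (ler_coord_norm _ _)); apply: UM Ux.
by rewrite ltrDl.
Qed.

Lemma compact_rV U : compact U <-> bounded_set U /\ closed U.
Proof.
split=> [cU|[]]; last exact: bounded_closed_compact.
by split; [exact: compact_bounded|apply: compact_closed => //; exact: norm_hausdorff].
Qed.

Lemma bounded_sub_rV U V : U `<=` V -> bounded_set V -> bounded_set U.
Proof.
by move=> UV [M [Mr VM]]; exists M; split => // y My x /UV; exact: VM.
Qed.

Lemma bounded_closed_box a b : bounded_set (closed_box a b).
Proof.
exists (\sum_i (`|a ord0 i| + `|b ord0 i|)); split=> [|M sM x xab].
  by rewrite num_real.
rewrite /= [X in X <= _]/Num.norm /= mx_normrE; apply/bigmax_leP; split=> [|[i j] _ /=].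
  by rewrite (le_trans _ (ltW sM))// sumr_ge0// => i _; rewrite addr_ge0.
rewrite ord1 (le_trans _ (ltW sM))// (bigD1 j)//= -[leLHS]addr0 lerD//; last first.
  by rewrite sumr_ge0// => k _; rewrite addr_ge0.
have /andP[aj jb] := xab j; rewrite ler_norml; apply/andP; split.
  by rewrite (le_trans _ aj)// lerNl (le_trans (ler_norm _))// normrN lerDl.
by rewrite (le_trans jb)// (le_trans (ler_norm _))// lerDr.
Qed.

Lemma compact_closed_box a b : compact (closed_box a b).
Proof.
by apply/compact_rV; split; [exact: bounded_closed_box|exact: closed_closed_box].
Qed.
End boxes.

(** * Lebesgue measure of boxes *)

Section box_measure.
Context {R : realType}.
Local Open Scope ereal_scope.

(** The induction peels off the first coordinate, as the iterated product does. In dimension 0 the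
    Dirac mass gives the one-point space the value 1 of the empty product. *)
Lemma lebesgue_rV_rectangle n (I : 'I_n -> set (measurableTypeR R)) :
  (forall i, measurable (I i)) ->
  lebesgue_rV n [set x : 'rV[R]_n | forall i, I i (x ord0 i)] =
  \prod_(i < n) lebesgue_measure (I i).
Proof.
elim: n I => [I _|n ih I mI].
  rewrite big_ord0 /= (_ : mkset _ = setT) ?diracT//.
  by apply/seteqP; split => // x _ [].
rewrite big_ord_recl -ih//.
rewrite [LHS]/= /lebesgue_succ /pushforward (_ : _ @^-1` _ =
  I ord0 `*` [set x : 'rV[R]_n | forall i, I (lift ord0 i) (x ord0 i)]).
  rewrite product_measure1E//.
  exact: (@measurable_coord_preimage _ _ (fun i => I (lift ord0 i))).
apply/seteqP; split=> [[t x] /= Itx|[t x] [/= It Ix] i].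
  split=> [|i]; first by have := Itx ord0; rewrite mxE unlift_none.
  by have := Itx (lift ord0 i); rewrite mxE liftK.
by rewrite mxE; case: unliftP => [j ->|->].
Qed.

Lemma lebesgue_open_box n (a b : 'rV[R]_n) :
  (forall i, a ord0 i <= b ord0 i)%R ->
  lebesgue_rV n (open_box a b) = (\prod_i (b ord0 i - a ord0 i))%R%:E.
Proof.
move=> ab; rewrite (_ : open_box a b =
  [set x : 'rV[R]_n | forall i, `]a ord0 i, b ord0 i[%classic (x ord0 i)]).
  rewrite (lebesgue_rV_rectangle (I := fun i => `]a ord0 i, b ord0 i[%classic)); last first.
    by move=> i; exact: measurable_itv.
  rewrite -prodEFin; apply: eq_bigr => i _; rewrite lebesgue_measure_itv/= lte_fin.
  have [//|ba] := ltP; congr EFin; apply/esym/eqP; rewrite subr_eq0.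
  by rewrite eq_le ba ab.
by apply/seteqP; split => x /= xab i; have := xab i; rewrite /= in_itv.
Qed.

Lemma lebesgue_rV_fin n (U : set 'rV[R]_n) : bounded_set U -> measurable U ->
  lebesgue_rV n U < +oo.
Proof.
move=> /bounded_sub_closed_box[M UM] mU.
(* [M] may be negative; the absolute value in the upper corner keeps the sides nonnegative in that
   case too. *)
have M' : (- M - 1 <= `|M| + 1)%R.
  by have := ler_norm (- M)%R; rewrite normrN; lra.
apply: (@le_lt_trans _ _ (lebesgue_rV n (open_box (const_mx (- M - 1)%R) (const_mx (`|M| + 1)%R)))).
  apply: le_measure; rewrite ?inE//; first exact: measurable_open_box.
  move=> x /UM xM i; have /andP[] := xM i; rewrite !mxE => Mx xM'.
  by rewrite (lt_le_trans _ Mx) ?ltrBlDr ?ltrDl//= (le_lt_trans xM')// ltr_pwDr// ler_norm.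
by rewrite lebesgue_open_box ?ltry// => i; rewrite !mxE.
Qed.

Lemma open_lebesgue_rV_gt0 n (U : set 'rV[R]_n) : open U -> U !=set0 ->
  0 < lebesgue_rV n U.
Proof.
move=> oU [x Ux]; have [[a b] /= [xab abU]] := open_box_nbhs oU Ux.
set B := open_box _ _ in xab.
apply: (@lt_le_trans _ _ (lebesgue_rV n B)); last first.
  apply: le_measure; rewrite ?inE; [exact: measurable_open_box|exact: measurable_open_rV|].
  by move=> y /open_boxW/abU.
rewrite lebesgue_open_box; last by move=> i; have /andP[/lt_trans h /h /ltW] := xab i.
by rewrite lte_fin prodr_gt0// => i _; rewrite subr_gt0; have /andP[/lt_trans h /h] := xab i.
Qed.

(** Boxes are stable under intersection, so this generating family is the one on which a Dynkin
    class argument can start. *)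
Lemma measurable_rVE n : @measurable _ 'rV[R]_n =
  <<s [set B | exists a b : 'rV[R]_n, B = open_box a b] >>.
Proof.
apply/seteqP; split=> A; last first.
  apply: smallest_sub; first exact: sigma_algebra_measurable.
  by move=> _ [a [b ->]]; exact: measurable_open_box.
move: A; apply: smallest_sub; first exact: smallest_sigma_algebra.
set G := [set B | _]; rewrite -bigcup_seq => _ [i _ [B mB <-]].
suff : measurable_fun setT (fun x : g_sigma_algebraType G => x ord0 i : measurableTypeR R).
  by move=> /(_ measurableT _ mB).
apply: (measurability _ (RGenOpens.measurableE R)) => _ [_ [s [t ->]] <-].
(* A slab that constrains coordinate [i] only is the union over [k] of boxes whose other sides are
   ]-k, k[. *)
pose c (e r : R) (k : nat) : 'rV[R]_n := \row_j if j == i then r else (e * k%:R)%R.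
rewrite setTI (_ : _ @^-1` _ = \bigcup_k open_box (c (-1)%R s k) (c 1%R t k)).
  by apply: bigcupT_measurable => k; apply: sub_sigma_algebra; do 2 eexists.
apply/seteqP; split=> [x /= /[!in_itv]/= xst|x [k _ /(_ i)]]; last first.
  by rewrite !mxE eqxx /= in_itv.
exists (Num.bound `|x|) => // j; rewrite !mxE; case: eqP => [->//|_].
rewrite mul1r mulN1r -ltr_norml (le_lt_trans (ler_coord_norm _ _))//.
exact: archi_boundP.
Qed.
End box_measure.

(** * Calculus of C^n functions *)

Section Ck_theory.
Context {R : realType} {d : nat}.
Implicit Types (f g : 'rV[R]_d -> R) (n : nat) (j : 'I_d).

Lemma Ck_continuous n f : Ck n f -> continuous f.
Proof. by case: n => [|n] []. Qed.

Lemma CkW n f : Ck n.+1 f -> Ck n f.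
Proof.
elim: n f => [|n ih] f [cf pf]; first by split.
by split=> // j; have [dpf Cpf] := pf j; split => //; exact: ih.
Qed.

Lemma Ck_derivable n f j x : Ck n.+1 f -> derivable f x (delta_mx ord0 j).
Proof. by case=> _ /(_ j)[]. Qed.

Lemma Ck_partial n f j : Ck n.+1 f -> Ck n (partial j f).
Proof. by case=> _ /(_ j)[]. Qed.

Lemma partialD n f g j : Ck n.+1 f -> Ck n.+1 g ->
  partial j (f + g) = partial j f + partial j g.
Proof.
move=> Cf Cg; apply/funext => x; rewrite /partial deriveD//.
  exact: (Ck_derivable Cf).
exact: (Ck_derivable Cg).
Qed.

Lemma partialM n f g j : Ck n.+1 f -> Ck n.+1 g ->
  partial j (f * g) = f * partial j g + g * partial j f.
Proof.
move=> Cf Cg; apply/funext => x; rewrite /partial deriveM//.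
  exact: (Ck_derivable Cf).
exact: (Ck_derivable Cg).
Qed.

Lemma partialZ n (c : R) f j : Ck n.+1 f -> partial j (c *: f) = c *: partial j f.
Proof.
move=> Cf; apply/funext => x; rewrite /partial deriveZ//.
exact: (Ck_derivable Cf).
Qed.

Lemma partial_cst (c : R) j : partial j (cst c : 'rV[R]_d -> R) = cst 0.
Proof. by apply/funext => x; rewrite /partial derive_cst. Qed.

Lemma Ck_cst n (c : R) : Ck n (cst c : 'rV[R]_d -> R).
Proof.
elim: n c => [|n ih] c; first by split => //; exact: cst_continuous.
split=> [|j]; first exact: cst_continuous.
by rewrite partial_cst; split => // x; exact: derivable_cst.
Qed.

Lemma CkD n f g : Ck n f -> Ck n g -> Ck n (f + g).
Proof.
elim: n f g => [|n ih] f g Cf Cg.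
  by split=> // x; apply: continuousD; [exact: (Ck_continuous Cf)|exact: (Ck_continuous Cg)].
split=> [x|j].
  by by apply: continuousD; [exact: (Ck_continuous Cf)|exact: (Ck_continuous Cg)].
split=> [x|]; first by exact: (derivableD (Ck_derivable Cf) (Ck_derivable Cg)).
by rewrite (partialD _ Cf)//; apply: ih; exact: Ck_partial.
Qed.

Lemma CkM n f g : Ck n f -> Ck n g -> Ck n (f * g).
Proof.
elim: n f g => [|n ih] f g Cf Cg.
  by split=> // x; apply: continuousM; [exact: (Ck_continuous Cf)|exact: (Ck_continuous Cg)].
split=> [x|j].
  by by apply: continuousM; [exact: (Ck_continuous Cf)|exact: (Ck_continuous Cg)].
split=> [x|]; first by exact: (derivableM (Ck_derivable Cf) (Ck_derivable Cg)).
rewrite (partialM _ Cf)//; apply: CkD; apply: ih; do ?exact: Ck_partial; exact: CkW.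
Qed.

Lemma CkZ n (c : R) f : Ck n f -> Ck n (c *: f).
Proof. by move=> Cf; rewrite (_ : c *: f = cst c * f)//; apply: CkM => //; exact: Ck_cst. Qed.

Lemma Ck_sum n (I : Type) (r : seq I) (P : pred I) (F : I -> 'rV[R]_d -> R) :
  (forall i, P i -> Ck n (F i)) -> Ck n (\sum_(i <- r | P i) F i).
Proof.
move=> CF; elim/big_rec : _ => [|i f Pi]; first exact: (Ck_cst n 0).
by apply: CkD; exact: CF.
Qed.

Lemma Ck_prod n (I : Type) (r : seq I) (P : pred I) (F : I -> 'rV[R]_d -> R) :
  (forall i, P i -> Ck n (F i)) -> Ck n (\prod_(i <- r | P i) F i).
Proof.
move=> CF; elim/big_rec : _ => [|i f Pi]; first exact: (Ck_cst n 1).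
by apply: CkM; exact: CF.
Qed.

Lemma Ck_exp n (m : nat) f : Ck n f -> Ck n (f ^+ m).
Proof.
move=> Cf; elim: m => [|m ih]; first exact: (Ck_cst n 1).
by rewrite exprS; exact: CkM.
Qed.

Lemma differentiable_coord_rV j x : differentiable (fun y : 'rV[R]_d => y ord0 j) x.
Proof. exact: differentiable_coord. Qed.

Lemma derive_coord (i j : 'I_d) x :
  'D_(delta_mx ord0 j) (fun y : 'rV[R]_d => y ord0 i) x = (i == j)%:R.
Proof.
rewrite /derive; apply: cvg_lim => //; apply: cvg_near_cst; near=> t.
have t0 : t != 0 by near: t; exact: nbhs_dnbhs_neq.
by rewrite /= !mxE/= addrK -[_ *: _]/(_ * _) mulrA mulVf// mul1r eq_sym.
Unshelve. all: by end_near. Qed.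

Lemma Ck_coord n j : Ck n (fun x : 'rV[R]_d => x ord0 j).
Proof.
case: n => [|n]; first by split=> //; exact: coord_continuous.
split=> [|i]; first exact: coord_continuous.
split=> [x|]; first exact/diff_derivable/differentiable_coord.
rewrite (_ : partial i _ = cst (j == i)%:R); first exact: Ck_cst.
by apply/funext => x; rewrite /partial derive_coord.
Qed.

End Ck_theory.

(** * The smooth function exp(-1/t) *)

Section exp_bump.
Context {R : realType}.
Implicit Types (p : {poly R}) (t : R).

(** The polynomial factor in 1/t makes the family closed under differentiation; [p = 1] is the
    classical flat function. *)
Definition exp_bump p t : R := if 0 < t then p.[t^-1] * expR (- t^-1) else 0.

(* d/dt (p(1/t) exp(-1/t)) = (p - p')(1/t) t^-2 exp(-1/t) *)
Definition exp_bump_deriv p : {poly R} := 'X^2 * (p - p^`()).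

(** For [N > 0], raise exp(-y) <= 1/y, where y = 1/(N t), to the power [N]. *)
Lemma expRN_le (N : nat) t : 0 < t -> expR (- t^-1) <= (N%:R * t) ^+ N.
Proof.
case: N => [|N] t0; first by rewrite expr0 -expR0 ler_expR oppr_le0 invr_ge0 ltW.
have N0 : 0 < N.+1%:R :> R by rewrite ltr0n.
rewrite -[X in expR X](mulfVK (lt0r_neq0 N0)) expRM_natr.
rewrite ler_pXn2r ?nnegrE ?expR_ge0 ?mulr_ge0 ?(ltW t0)//.
rewrite mulNr expRN -[leRHS]invrK lef_pV2 ?posrE ?expR_gt0 ?invr_gt0 ?mulr_gt0//.
by rewrite invfM mulrC (le_trans _ (expR_ge1Dx _))// lerDr.
Qed.

Lemma exp_bump_bound p : exists C : R, 0 <= C /\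
  forall t, `|t| <= 1 -> `|exp_bump p t| <= C * t ^+ 2.
Proof.
(* The powers of 1/t have exponent [i < size p], so this [N] leaves at least two factors [t] after
   cancellation. *)
pose N := (size p).+1.
exists (\sum_(i < size p) `|p`_i| * N%:R ^+ N); split.
  by apply: sumr_ge0 => i _; rewrite mulr_ge0// exprn_ge0.
move=> t; rewrite /exp_bump; case: ifPn => t0; last first.
  by rewrite normr0 mulr_ge0 ?sqr_ge0// sumr_ge0// => i _; rewrite mulr_ge0// exprn_ge0.
rewrite (gtr0_norm t0) => t1.
rewrite normrM (gtr0_norm (expR_gt0 _)) horner_coef.
rewrite mulr_suml (le_trans (ler_wpM2r (expR_ge0 _) (ler_norm_sum _ _ _)))//.
rewrite mulr_suml ler_sum// => i _.
rewrite normrM normrX (gtr0_norm (_ : 0 < t^-1)) ?invr_gt0// -!mulrA ler_wpM2l//.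
apply: (le_trans (ler_wpM2l _ (expRN_le N t0))).
  by rewrite exprn_ge0// invr_ge0 ltW.
rewrite exprMn mulrCA ler_wpM2l ?exprn_ge0//.
have iN : (i <= N)%N by rewrite (leq_trans (ltnW (ltn_ord i)))//.
rewrite -{1}(subnK iN) exprD mulrC -mulrA -exprMn divff ?gt_eqF// expr1n mulr1.
have -> : (N - i = (size p - i).-1 + 2)%N.
  by rewrite /N subSn ?(ltnW (ltn_ord i))//; have := ltn_ord i; lia.
by rewrite exprD ler_piMl ?sqr_ge0// exprn_ile1// ltW.
Qed.

Lemma is_derive_exp_bump p t : is_derive t 1 (exp_bump p) (exp_bump (exp_bump_deriv p) t).
Proof.
have [t0|t0|t0] := ltgtP 0 t.
- rewrite /exp_bump t0.
  apply: (@near_eq_is_derive _ _ _ ((horner p \o GRing.inv) * (expR \o (fun s => - s^-1)))).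
    by near=> s; rewrite ifT//; near: s; exact: lt_nbhsr.
  have tn0 : t != 0 by rewrite gt_eqF.
  have dV : is_derive t 1 (fun s : R => s^-1) (- t ^- 2).
    apply: DeriveDef; first exact: (@derivableV _ _ id).
    by rewrite (@deriveV _ _ id)// derive_id -[_ *: _]/(_ * _) mulr1.
  have dN : is_derive t 1 (fun s : R => - s^-1) (t ^- 2).
    by apply: is_derive_eq; rewrite opprK.
  have dp := is_derive1_comp (is_derive_poly p t^-1) dV.
  have de := @is_derive1_comp _ expR (fun s => - s^-1) t _ _ (is_derive_expR _) dN.
  apply: is_derive_eq (is_deriveM dp de) _ => /=.
  rewrite -![_ *: _]/(_ * _) /exp_bump_deriv hornerM hornerXn hornerD hornerN -exprVn.
  by move: (t^-1) => s; ring.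
- rewrite /exp_bump ltNge (ltW t0)/=.
  apply: (@near_eq_is_derive R R R (cst 0)).
  by near=> s; rewrite ltNge ltW//; near: s; exact: lt_nbhsl.
(* At 0 the difference quotient is at most [C * |h|]. *)
- rewrite -t0; have [C [C0 CP]] := exp_bump_bound p.
  have f0 q : exp_bump q 0 = 0 by rewrite /exp_bump ltxx.
  have cv : h^-1 *: ((exp_bump p \o shift 0) (h *: (1 : R)) - exp_bump p 0) @[h --> 0^'] --> (0:R).
    apply/cvgr0Pnorm_le => e e0; near=> h.
    have h0 : h != 0 by near: h; exact: nbhs_dnbhs_neq.
    rewrite f0 subr0 /= addr0 -![_ *: _]/(_ * _) mulr1 normrM normfV.
    rewrite ler_pdivrMl ?normr_gt0//.
    have h1 : `|h| <= 1 by near: h; apply: dnbhs0_le.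
    rewrite (le_trans (CP h h1))// -real_normK ?num_real// expr2 mulrA mulrC.
    (* [C] may be 0, and the next step divides by this constant. *)
    rewrite ler_wpM2l// (@le_trans _ _ ((C + 1) * `|h|))//.
      by rewrite ler_wpM2r// lerDl.
    rewrite -ler_pdivlMl ?ltr_wpDl// mulrC.
    by near: h; apply: dnbhs0_le; rewrite divr_gt0// ltr_wpDl.
  by rewrite f0; apply: DeriveDef; [apply/cvg_ex; exists 0|exact: cvg_lim].
Unshelve. all: by end_near. Qed.

Lemma derivable_exp_bump p t : derivable (exp_bump p) t 1.
Proof. by have [] := is_derive_exp_bump p t. Qed.

Lemma continuous_exp_bump p : continuous (exp_bump p).
Proof.
move=> t; apply: differentiable_continuous.
exact/derivable1_diffP/derivable_exp_bump.
Qed.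

(** The induction on [n] is uniform in [p]: each partial derivative is a multiple of the same kind
    of function, with polynomial [exp_bump_deriv p]. *)
Lemma Ck_exp_bump d n p (c a : R) (j : 'I_d) :
  Ck n (fun x : 'rV[R]_d => exp_bump p (c * x ord0 j + a)).
Proof.
pose l : 'rV[R]_d -> R := c *: (fun x : 'rV[R]_d => x ord0 j) + cst a.
have Cl : forall m, Ck m l.
  by move=> m; apply: CkD; [apply/CkZ/Ck_coord|exact: Ck_cst].
elim: n p => [|n ih] p.
  by split=> // x; apply: (@continuous_comp _ _ _ l); [exact: (Ck_continuous (Cl 0))|exact: continuous_exp_bump].
split=> [x|i].
  by apply: (@continuous_comp _ _ _ l); [exact: (Ck_continuous (Cl 0))|exact: continuous_exp_bump].
have dl x : differentiable l x.
  apply: differentiableD; last exact: differentiable_cst.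
  by apply: differentiableZ; exact: differentiable_coord_rV.
have de t : differentiable (exp_bump p) t by exact/derivable1_diffP/derivable_exp_bump.
split=> [x|].
  by apply: diff_derivable; exact: (differentiable_comp (dl x) (de (l x))).
rewrite (_ : partial i _ = (c * (j == i)%:R) *:
  (fun x : 'rV[R]_d => exp_bump (exp_bump_deriv p) (c * x ord0 j + a))).
  exact/CkZ/ih.
apply/funext => x; rewrite /partial deriveE; last exact: (differentiable_comp (dl x) (de (l x))).
rewrite (_ : (fun _ => _) = exp_bump p \o l)// diff_comp//=.
rewrite (_ : 'd l x _ = c * (j == i)%:R).
  rewrite diff1E// derive1E; congr (_ *: _).
  by have [_ ->] := is_derive_exp_bump p (l x).
rewrite -deriveE// /l deriveD.
- rewrite derive_cst addr0 deriveZ ?derive_coord//.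
  exact: (Ck_derivable (Ck_coord 1 j)).
- exact: (Ck_derivable (CkZ _ (Ck_coord 1 j))).
- exact: derivable_cst.
Qed.

End exp_bump.

(** * Algebra of test functions *)

Section test_functions.
Context {R : realType} {d : nat}.
Notation vec := 'rV[R]_d.
Variable Om : set vec.
Implicit Types (f g phi : vec -> R).

Lemma test_Ck n phi : test_function Om phi -> Ck n phi.
Proof. by case. Qed.

Lemma closure_supp_sub f g : (forall x, f x = 0 -> g x = 0) ->
  closure [set x | g x != 0] `<=` closure [set x | f x != 0].
Proof.
by move=> fg; apply: closure_subset => x /=; apply: contra_neq; exact: fg.
Qed.

Lemma test_function_sub f g : test_function Om f -> (forall n, Ck n g) ->
  closure [set x | g x != 0] `<=` closure [set x | f x != 0] ->
  test_function Om g.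
Proof.
move=> [_ cf fO] Cg gf; split=> //; last exact: subset_trans fO.
by apply: subclosed_compact cf gf; exact: closed_closure.
Qed.

Lemma test_function0 : test_function Om (cst 0).
Proof.
rewrite /test_function (_ : [set x | _] = set0); last first.
  by apply/seteqP; split => x //=; rewrite eqxx.
by split => [n||]; rewrite ?closure0//; [exact: Ck_cst|exact: compact0].
Qed.

Lemma test_functionD f g : test_function Om f -> test_function Om g ->
  test_function Om (f + g).
Proof.
move=> [Cf cf fO] [Cg cg gO].
have sub : closure [set x | (f + g) x != 0] `<=`
    closure [set x | f x != 0] `|` closure [set x | g x != 0].
  rewrite -closureU; apply: closure_subset => x /=.
  have [fx0|] := eqVneq (f x) 0; last by left.
  by rewrite fctE fx0 add0r => gx; right.
split=> [n||]; first exact: CkD.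
  by apply: subclosed_compact (compactU cf cg) sub; exact: closed_closure.
by move=> x /sub[/fO|/gO].
Qed.

Lemma test_functionZ (c : R) f : test_function Om f -> test_function Om (c *: f).
Proof.
move=> tf; apply: (test_function_sub tf) => [n|]; first exact/CkZ/test_Ck.
by apply: closure_supp_sub => x fx; rewrite fctE fx scaler0.
Qed.

Lemma test_functionM f g : test_function Om f -> test_function Om g ->
  test_function Om (f * g).
Proof.
move=> tf tg; apply: (test_function_sub tf) => [n|].
  by apply: CkM; exact: test_Ck.
by apply: closure_supp_sub => x fx; rewrite fctE fx mul0r.
Qed.

(** Off its closed support [f] vanishes in a neighbourhood, so the derivative is 0 there and the
    support does not grow. *)
Lemma test_function_partial j f : test_function Om f -> test_function Om (partial j f).
Proof.
move=> tf; apply: (test_function_sub tf) => [n|].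
  by have /Ck_partial := test_Ck n.+1 tf.
have /closure_id -> : closed (closure [set x | f x != 0]) by exact: closed_closure.
apply: closure_subset => x /= /eqP fx; apply: contrapT => nfx; apply: fx.
rewrite /partial.
rewrite (@near_eq_derive _ _ _ _ (cst 0)) ?derive_cst//.
have : nbhs x (~` closure [set x | f x != 0]).
  by apply: open_nbhs_nbhs; split => //; exact/closed_openC/closed_closure.
apply: filterS => y; apply: contra_notP => /eqP fy.
exact: subset_closure.
Qed.

Lemma test_function_bounded f : test_function Om f ->
  exists M : R, forall x, `|f x| <= M.
Proof.
move=> tf; have cf := Ck_continuous (test_Ck 0 tf); case: tf => _ cK _.
set K := closure _ in cK.
have : compact ((fun x => `|f x|) @` K).
  apply: continuous_compact => //; apply: continuous_subspaceT => x.
  by apply: continuous_comp; [exact: cf|exact: norm_continuous].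
move=> /compact_bounded[M [_ /(_ (M + 1))]]; rewrite ltrDl ltr01 => /(_ isT) KM.
exists (Num.max 0 (M + 1)) => x; have [->|fx] := eqVneq (f x) 0.
  by rewrite normr0 le_max lexx.
rewrite le_max; apply/orP; right; rewrite -[leLHS]normr_id; apply: KM.
by exists x => //; exact: subset_closure.
Qed.

End test_functions.

(** * Smooth approximation of indicators of boxes *)

Section box_bump.
Context {R : realType} {d : nat}.
Notation vec := 'rV[R]_d.
Implicit Types (a b x : vec) (n : nat).

(** The slope [n.+1] sharpens the edges: exp(-1/((n+1)t)) tends to 1 for each t > 0, and the factor
    is 0 for t <= 0. The pointwise limit is therefore the indicator of the open box. *)
Definition box_bump a b n x : R := \prod_j
  (exp_bump 1 (n.+1%:R * x ord0 j - n.+1%:R * a ord0 j) *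
   exp_bump 1 ((- n.+1%:R) * x ord0 j + n.+1%:R * b ord0 j)).

Lemma exp_bump1_ge0_le1 (t : R) : 0 <= exp_bump 1 t <= 1.
Proof.
rewrite /exp_bump; case: ifPn => t0; last by rewrite lexx ler01.
by rewrite hornerE mul1r expR_ge0 -expR0 ler_expR oppr_le0 invr_ge0 ltW.
Qed.

Lemma exp_bump1_eq0 (t : R) : (exp_bump 1 t == 0) = (t <= 0).
Proof.
rewrite /exp_bump; case: ltP => t0; last by rewrite eqxx.
by rewrite hornerE mul1r gt_eqF// expR_gt0.
Qed.

Lemma cvg_exp_bump1 (t : R) :
  exp_bump 1 (n.+1%:R * t) @[n --> \oo] --> ((0 < t)%R%:R : R).
Proof.
have [t0|t0] := ltP 0 t; last first.
  apply: cvg_near_cst; apply: nearW => n; apply/eqP; rewrite exp_bump1_eq0.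
  by rewrite mulr_ge0_le0.
rewrite (_ : (fun _ => _) = (fun n => expR (- (n.+1%:R^-1 * t^-1)))); last first.
  by apply/funext => n; rewrite /exp_bump mulr_gt0// hornerE mul1r invfM.
rewrite -[X in _ --> X]expR0 -oppr0 -(mul0r t^-1).
apply: (continuous_cvg _ (@continuous_expR R _)); apply: cvgN.
by apply: cvgMr_tmp; exact: cvg_harmonic.
Qed.

Lemma box_bump_ge0_le1 a b n x : 0 <= box_bump a b n x <= 1.
Proof.
have h j : 0 <= exp_bump 1 (n.+1%:R * x ord0 j - n.+1%:R * a ord0 j) *
   exp_bump 1 ((- n.+1%:R) * x ord0 j + n.+1%:R * b ord0 j) <= 1.
  have /andP[a0 a1] := exp_bump1_ge0_le1 (n.+1%:R * x ord0 j - n.+1%:R * a ord0 j).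
  have /andP[b0 b1] := exp_bump1_ge0_le1 ((- n.+1%:R) * x ord0 j + n.+1%:R * b ord0 j).
  by rewrite mulr_ge0//= mulr_ile1.
apply: (big_ind (fun y => 0 <= y <= 1)) => [|y z /andP[y0 y1] /andP[z0 z1]|j _ //].
  by rewrite ler01 lexx.
by rewrite mulr_ge0//= mulr_ile1.
Qed.

Lemma cvg_box_bump a b x :
  box_bump a b n x @[n --> \oo] --> (\1_(open_box a b) x : R).
Proof.
rewrite (_ : \1_(open_box a b) x =
  \prod_j ((0 < x ord0 j - a ord0 j)%R%:R * (0 < b ord0 j - x ord0 j)%R%:R)); last first.
  rewrite indicE; have [xab|/negP xab] := boolP (x \in open_box a b).
    rewrite big1// => j _; move: xab; rewrite inE => /(_ j)/andP[ax xb].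
    by rewrite !subr_gt0 ax xb mulr1.
  apply/esym/eqP/prodf_eq0; apply: contrapT => nx; apply: xab; rewrite inE => j.
  apply: contrapT => /negP jx; apply: nx; exists j => //.
  by move: jx; rewrite !subr_gt0 negb_and => /orP[]/negbTE ->; rewrite ?mul0r ?mulr0.
apply: cvg_big => // [|j _]; first exact: mul_continuous.
apply: cvgM.
  by under eq_fun do rewrite -mulrBr; exact: cvg_exp_bump1.
by under eq_fun do rewrite mulNr addrC -mulrBr; exact: cvg_exp_bump1.
Qed.

Lemma test_function_box_bump Om a b n : closed_box a b `<=` Om ->
  test_function Om (box_bump a b n).
Proof.
move=> abO; have sub : closure [set x | box_bump a b n x != 0] `<=` closed_box a b.
  have /closure_id -> := @closed_closed_box R d a b.
  apply: closure_subset => x /= /prodf_neq0 nx i.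
  have := nx i isT; rewrite mulf_eq0 negb_or !exp_bump1_eq0 -!ltNge => /andP[].
  rewrite subr_gt0 mulNr addrC subr_gt0 !ltr_pM2l// => ax xb.
  by rewrite !ltW.
split=> [m||]; last exact: subset_trans abO.
  rewrite (_ : box_bump a b n = \prod_j
    ((fun x => exp_bump 1 (n.+1%:R * x ord0 j - n.+1%:R * a ord0 j)) *
     (fun x => exp_bump 1 ((- n.+1%:R) * x ord0 j + n.+1%:R * b ord0 j)))); last first.
    by apply/funext => x; rewrite fct_prodE.
  by apply: Ck_prod => j _; apply: CkM; exact: Ck_exp_bump.
by apply: subclosed_compact sub; [exact: closed_closure|exact: compact_closed_box].
Qed.
End box_bump.

(** * Inner product and convergence in L2 *)

Section L2_theory.
Context {R : realType} {d : nat}.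
Notation vec := 'rV[R]_d.
Notation mu := (@lebesgue_rV R d).
Variable Om : set vec.
Hypothesis mOm : measurable Om.
Implicit Types (f g c : vec -> R).

Lemma L2_measurable f : L2 Om f -> measurable_fun Om f.
Proof. by case. Qed.

Lemma L2_integrable_sqr f : L2 Om f -> mu.-integrable Om (EFin \o (fun x => f x ^+ 2)).
Proof. by case. Qed.

Lemma L2M_integrable f g : L2 Om f -> L2 Om g ->
  mu.-integrable Om (EFin \o (fun x => f x * g x)).
Proof.
move=> [mf f2] [mg g2]; have := integrableD mOm f2 g2; apply: le_integrable => //.
  by apply/measurable_EFinP; exact: measurable_funM.
move=> x _ /=; rewrite lee_fin normrM [leRHS]ger0_norm ?addr_ge0 ?sqr_ge0//.
rewrite -(real_normK (num_real (f x))) -(real_normK (num_real (g x))).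
by move: `|f x| `|g x| (normr_ge0 (f x)) (normr_ge0 (g x)) => a b a0 b0; nra.
Qed.

Lemma L2D f g : L2 Om f -> L2 Om g -> L2 Om (fun x => f x + g x).
Proof.
move=> Lf Lg; have [[mf f2] [mg g2]] := (Lf, Lg).
split; first exact: measurable_funD.
have fg := integrableZl mOm 2 (L2M_integrable Lf Lg).
apply: eq_integrable (integrableD mOm (integrableD mOm f2 g2) fg) => // x _ /=.
by rewrite -EFinM -!EFinD; congr EFin; ring.
Qed.

Lemma L2Z (k : R) f : L2 Om f -> L2 Om (fun x => k * f x).
Proof.
move=> [mf f2]; split; first exact: measurable_funM.
apply: eq_integrable (integrableZl mOm (k ^+ 2) f2) => // x _ /=.
by rewrite -EFinM exprMn.
Qed.

Lemma L2B f g : L2 Om f -> L2 Om g -> L2 Om (fun x => f x - g x).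
Proof.
move=> Lf Lg; have := L2D Lf (L2Z (-1) Lg).
by under eq_fun do rewrite mulN1r.
Qed.

Lemma Linf_bound c : Linf Om c ->
  exists2 C : R, 0 <= C & {ae mu, forall x, Om x -> `|c x| <= C}.
Proof.
(* The norm is an essential supremum only if the whole space has positive measure; otherwise every
   property holds almost everywhere. *)
move=> [mc coo]; have [mT0|] := ltP 0%E (mu setT); last first.
  move=> T0; exists 0 => //; exists setT; split => //.
  by apply/eqP; rewrite eq_le T0 measure_ge0.
move: coo; rewrite /Linf_norm unlock mT0.
set f := (abse \o _); move=> foo; exists (fine (ess_sup mu f)).
  rewrite fine_ge0//; apply: ess_sup_gee => //.
  by apply: aeW => x /=; exact: abse_ge0.
apply: filterS (ess_sup_ge mu f) => x + Omx; rewrite /f /= patchE mem_set//=.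
move=> h; rewrite -lee_fin fineK//.
by rewrite ge0_fin_numE// (le_trans _ h)// lee_fin.
Qed.

Lemma L2_Linf c f : Linf Om c -> L2 Om f -> L2 Om (fun x => c x * f x).
Proof.
move=> Lc [mf f2]; have [mc _] := Lc; have [C C0 cC] := Linf_bound Lc.
have mcf : measurable_fun Om (fun x => c x * f x) by exact: measurable_funM.
have mcf2 : measurable_fun Om (EFin \o (fun x => (c x * f x) ^+ 2)).
  by apply/measurable_EFinP; exact: measurable_funX.
split => //; apply/integrableP; split=> //.
have /integrableP[mC Coo] := integrableZl mOm (C ^+ 2) f2.
apply: le_lt_trans Coo; apply: ae_ge0_le_integral => //.
- exact: measurableT_comp.
- exact: measurableT_comp.
apply: filterS cC => x cC /cC {}cC.
rewrite /= lee_fin exprMn ger0_norm; last by rewrite mulr_ge0 ?sqr_ge0.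
rewrite ger0_norm; last by rewrite mulr_ge0 ?sqr_ge0.
by rewrite ler_wpM2r ?sqr_ge0// -real_normK ?num_real// ler_pXn2r ?nnegrE.
Qed.

Definition L2_ip f g : R := \int[mu]_(x in Om) (f x * g x).
Local Notation ip := L2_ip.

Lemma ipC f g : ip f g = ip g f.
Proof. by apply: eq_Rintegral => x _; rewrite mulrC. Qed.

Lemma ipDl f g h : L2 Om f -> L2 Om g -> L2 Om h ->
  ip (fun x => f x + g x) h = ip f h + ip g h.
Proof.
move=> Lf Lg Lh; rewrite -RintegralD//; [|exact: L2M_integrable..].
by apply: eq_Rintegral => x _; rewrite mulrDl.
Qed.

Lemma ipZl (k : R) f g : L2 Om f -> L2 Om g ->
  ip (fun x => k * f x) g = k * ip f g.
Proof.
move=> Lf Lg; rewrite -RintegralZl//; last exact: L2M_integrable.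
by apply: eq_Rintegral => x _; rewrite mulrA.
Qed.

Lemma ipBl f g h : L2 Om f -> L2 Om g -> L2 Om h ->
  ip (fun x => f x - g x) h = ip f h - ip g h.
Proof.
move=> Lf Lg Lh; rewrite -RintegralB//; [|exact: L2M_integrable..].
by apply: eq_Rintegral => x _; rewrite mulrBl.
Qed.

Lemma ipDr f g h : L2 Om f -> L2 Om g -> L2 Om h ->
  ip h (fun x => f x + g x) = ip h f + ip h g.
Proof. by move=> Lf Lg Lh; rewrite ipC ipDl// ![ip _ h]ipC. Qed.

Lemma ipBr f g h : L2 Om f -> L2 Om g -> L2 Om h ->
  ip h (fun x => f x - g x) = ip h f - ip h g.
Proof. by move=> Lf Lg Lh; rewrite ipC ipBl// ![ip _ h]ipC. Qed.

Lemma ipZr (k : R) f g : L2 Om f -> L2 Om g ->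
  ip g (fun x => k * f x) = k * ip g f.
Proof. by move=> Lf Lg; rewrite ipC ipZl// ipC. Qed.

Lemma ip_ge0 f : 0 <= ip f f.
Proof. by apply: Rintegral_ge0 => x _; rewrite -expr2 sqr_ge0. Qed.

Lemma eq_ip f f' g g' : L2 Om f -> L2 Om f' -> L2 Om g -> L2 Om g' ->
  {ae mu, forall x, Om x -> f x = f' x} -> {ae mu, forall x, Om x -> g x = g' x} ->
  ip f g = ip f' g'.
Proof.
move=> [mf _] [mf' _] [mg _] [mg' _] ff gg; congr fine; apply: ae_eq_integral => //.
- by apply/measurable_EFinP; exact: measurable_funM.
- by apply/measurable_EFinP; exact: measurable_funM.
- by apply: filterS2 ff gg => x ff gg Ox /=; rewrite ff// gg.
Qed.

Lemma ip_CS f g : L2 Om f -> L2 Om g -> ip f g ^+ 2 <= ip f f * ip g g.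
Proof.
move=> Lf Lg.
have H t : 0 <= ip f f + 2 * t * ip f g + t ^+ 2 * ip g g.
  have := ip_ge0 (fun x => f x + t * g x).
  have Ltg := L2Z t Lg.
  rewrite ipDl ?ipDr ?ipZl ?ipZr//; last exact: L2D.
  by rewrite (ipC g f); lra.
have g0 := ip_ge0 g; have f0 := ip_ge0 f.
move: g0; rewrite le_eqVlt => /predU1P[g0|g0].
  rewrite -g0 mulr0; have [->|fg0] := eqVneq (ip f g) 0; first by rewrite expr0n.
  (* With [ip g g = 0] the quadratic is affine in [t], and this [t] gives it the value -1. *)
  have := H (- (ip f f + 1) / (2 * ip f g)); rewrite -g0 mulr0 addr0.
  rewrite (_ : 2 * _ * _ = - (ip f f + 1)); first lra.
  by field.
(* The minimizer of the quadratic. *)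
have := H (- ip f g / ip g g).
rewrite (_ : _ + _ = ip f f - ip f g ^+ 2 / ip g g); last by field; rewrite gt_eqF.
by rewrite subr_ge0 ler_pdivrMr.
Qed.

Lemma ip_eq0 f : L2 Om f -> ip f f = 0 -> {ae mu, forall x, Om x -> f x = 0}.
Proof.
move=> Lf; have /integrableP[mf2 f2] := L2_integrable_sqr Lf => f0.
have : (\int[mu]_(x in Om) `|(EFin \o (fun x => f x ^+ 2)%R) x| = 0)%E.
  rewrite -[LHS]fineK; last by rewrite ge0_fin_numE// integral_ge0.
  rewrite -[RHS]/(0%:E) -f0; congr EFin; congr fine; apply: eq_integral => x _ /=.
  by rewrite ger0_norm ?sqr_ge0.
move/ae_eq_integral_abs => /(_ mOm mf2); apply: filterS => x h /h /=.
by move=> [] /eqP; rewrite sqrf_eq0 => /eqP.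
Qed.

Definition L2_cvg (u : nat -> vec -> R) f : Prop :=
  ip (fun x => u n x - f x) (fun x => u n x - f x) @[n --> \oo] --> (0 : R).

(** Cauchy-Schwarz for a null sequence against a bounded one. *)
Lemma ip_cvg0 (u v : nat -> vec -> R) (M : R) :
  (forall n, L2 Om (u n)) -> (forall n, L2 Om (v n)) ->
  ip (u n) (u n) @[n --> \oo] --> (0 : R) -> (\forall n \near \oo, ip (v n) (v n) <= M) ->
  ip (u n) (v n) @[n --> \oo] --> (0 : R).
Proof.
move=> Lu Lv u0 vM; apply/cvgr0Pnorm_le => e e0.
have M1 : 0 < `|M| + 1 by rewrite ltr_wpDl.
have /cvgr0Pnorm_le/(_ (e ^+ 2 / (`|M| + 1))) := u0.
rewrite divr_gt0 ?exprn_gt0// => /(_ isT) {}u0; near=> n.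
rewrite -ler_sqr ?nnegrE ?(ltW e0)// real_normK ?num_real//.
apply: (le_trans (ip_CS (Lu n) (Lv n))).
have un : ip (u n) (u n) <= e ^+ 2 / (`|M| + 1).
  by rewrite (le_trans (ler_norm _))//; near: n.
have vn : ip (v n) (v n) <= `|M| + 1.
  by rewrite (@le_trans _ _ M)//; [near: n|rewrite ler_wpDr// ler_norm].
by rewrite -[leRHS](mulfVK (lt0r_neq0 M1)) ler_pM ?ip_ge0.
Unshelve. all: by end_near. Qed.

Lemma cvg_ip u v f g : (forall n, L2 Om (u n)) -> (forall n, L2 Om (v n)) ->
  L2 Om f -> L2 Om g -> L2_cvg u f -> L2_cvg v g ->
  ip (u n) (v n) @[n --> \oo] --> ip f g.
Proof.
move=> Lu Lv Lf Lg uf vg.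
have Luf n : L2 Om (fun x => u n x - f x) by exact: L2B.
have Lvg n : L2 Om (fun x => v n x - g x) by exact: L2B.
(* Each of the first three products pairs a factor tending to 0 with a bounded one. *)
have E n : ip (u n) (v n) = ip (fun x => u n x - f x) (fun x => v n x - g x) +
  ip (fun x => u n x - f x) g + ip (fun x => v n x - g x) f + ip f g.
  rewrite !ipBl// ?ipBr// (ipC (v n) f) (ipC g f).
  by lra.
rewrite -[X in _ --> X]add0r (eq_cvg _ _ E); apply: cvgD; last exact: cvg_cst.
rewrite -[X in _ --> X]addr0; apply: cvgD.
  rewrite -[X in _ --> X]addr0; apply: cvgD.
    apply: (@ip_cvg0 _ _ 1) => //.
    have /cvgr0Pnorm_le/(_ 1 ltr01) := vg; apply: filterS => n.
    exact/le_trans/ler_norm.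
  by apply: (@ip_cvg0 _ _ (ip g g)) => //; exact: nearW.
by apply: (@ip_cvg0 _ _ (ip f f)) => //; exact: nearW.
Qed.

End L2_theory.

(** * Fundamental lemma of the calculus of variations *)

Section fundamental_lemma.
Context {R : realType} {d : nat}.
Notation vec := 'rV[R]_d.
Notation mu := (@lebesgue_rV R d).
Implicit Types (f g : vec -> R) (a b : vec).

Lemma open_boxI a b a' b' : open_box a b `&` open_box a' b' =
  open_box (\row_i Num.max (a ord0 i) (a' ord0 i)) (\row_i Num.min (b ord0 i) (b' ord0 i)).
Proof.
apply/seteqP; split=> [x [xab xab'] i|x xab].
  by rewrite !mxE gt_max lt_min; have /andP[-> ->] := xab i; have /andP[-> ->] := xab' i.
by split=> i; have := xab i; rewrite !mxE gt_max lt_min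
  => /andP[/andP[? ?] /andP[? ?]]; apply/andP.
Qed.

(** The sets over which [g] integrates to 0 form a Dynkin class, the vanishing total integral giving
    complements. It contains the intersection-stable family of boxes, hence all measurable sets. *)
Lemma box_integral_eq0_ae g : mu.-integrable setT (EFin \o g) ->
  (\int[mu]_x (g x)%:E = 0)%E ->
  (forall a b, \int[mu]_(x in open_box a b) (g x)%:E = 0)%E ->
  {ae mu, forall x, g x = 0}.
Proof.
move=> ig gT gB.
have [mg _] := integrableP _ _ _ ig.
have iS S : measurable S -> mu.-integrable S (EFin \o g).
  by move=> mS; exact: integrableS ig.
pose P (S : set vec) := (\int[mu]_(x in S) (g x)%:E = 0)%E.
have PS : forall S, measurable S -> P S.
  rewrite measurable_rVE; apply: dynkin_induction; rewrite /P.
  - exact: measurable_rVE.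
  - by move=> _ _ [a [b ->]] [a' [b' ->]]; rewrite open_boxI; do 2 eexists.
  - exact: gT.
  - by move=> _ [a [b ->]]; exact: gB.
  - move=> S mS S0; move: gT; rewrite -(setUv S) integral_setU//.
    + by rewrite S0 add0e.
    + exact: measurableC.
    + by rewrite setUv.
    + by apply/disj_setPS => x [].
  - move=> F mF tF F0; rewrite (@integral_bigcup _ _ _ mu F (EFin \o g))//.
      by apply: eseries0 => n _ _; exact: F0.
    by apply: iS; exact: bigcup_measurable.
have : ae_eq mu setT (EFin \o g) (cst 0%E).
  apply: integral_ae_eq => // E _ mE; rewrite integral0; exact: PS.
by apply: filterS => x /(_ I)[].
Qed.

Variable Om : set vec.
Hypotheses (oOm : open Om) (bOm : bounded_set Om).

Let mOm : measurable Om. Proof. exact: measurable_open_rV. Qed.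

Lemma L2_bounded f (M : R) : measurable_fun Om f -> (forall x, Om x -> `|f x| <= M) ->
  L2 Om f.
Proof.
move=> mf fM; split=> //; apply: measurable_bounded_integrable => //.
- exact: lebesgue_rV_fin.
- exact: measurable_funX.
exists (M ^+ 2); split; first exact: num_real.
move=> A MA x Ox /=; rewrite ger0_norm ?sqr_ge0// (le_trans _ (ltW MA))//.
have M0 : 0 <= M by exact: le_trans (fM x Ox).
by rewrite -real_normK ?num_real// ler_pXn2r ?nnegrE// fM.
Qed.

Lemma L2_integrable f : L2 Om f -> mu.-integrable Om (EFin \o f).
Proof.
move=> Lf; have L1 : L2 Om (cst 1).
  by apply: (@L2_bounded _ 1) => // x _; rewrite normr1.
by apply: eq_integrable (L2M_integrable mOm Lf L1) => // x _ /=; rewrite mulr1.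
Qed.

Lemma L2_test phi : test_function Om phi -> L2 Om phi.
Proof.
move=> tphi; have [M phiM] := test_function_bounded tphi.
apply: (@L2_bounded _ M) => //.
by apply: continuous_measurable_rV => //; exact: (Ck_continuous (test_Ck 0 tphi)).
Qed.

(** Dominated convergence: the bumps are at most 1, and |f| is integrable because [Om] is
    bounded. *)
Lemma ip_box_bump_cvg f a b : L2 Om f -> closed_box a b `<=` Om ->
  (\int[mu]_(x in Om) (f x * box_bump a b n x)%:E @[n --> \oo] -->
   \int[mu]_(x in open_box a b) (f x)%:E)%E.
Proof.
move=> Lf abO.
have -> : (\int[mu]_(x in open_box a b) (f x)%:E =
           \int[mu]_(x in Om) (f x * \1_(open_box a b) x)%:E)%E.
  rewrite (_ : open_box a b = Om `&` open_box a b); last first.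
    by apply/esym/setIidr => x /open_boxW; exact: abO.
  rewrite integral_mkcondr; apply: eq_integral => x Ox.
  rewrite patchE indicE in_setI Ox/=.
  by case: ifPn; rewrite ?mulr1 ?mulr0.
have [] := @dominated_convergence _ _ _ mu Om mOm
  (fun n x => (f x * box_bump a b n x)%:E) (fun x => (f x * \1_(open_box a b) x)%:E)
  (fun x => `|(f x)%:E|%E).
- move=> n; apply/measurable_EFinP/measurable_funM; first exact: L2_measurable.
  by apply: L2_measurable; apply: L2_test; exact: test_function_box_bump.
- apply/measurable_EFinP/measurable_funM; first exact: L2_measurable.
  by apply: measurable_indic; exact: measurable_open_box.
- apply: aeW => x _; apply: cvg_EFin; first exact: nearW.
  apply: (@cvgM _ _ _ _ (fun=> f x) (fun n => box_bump a b n x)); first exact: cvg_cst.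
  exact: cvg_box_bump.
- exact/integrable_abse/L2_integrable.
- apply: aeW => x n _ /=; rewrite lee_fin normrM ler_piMr//.
  by have /andP[? ?] := box_bump_ge0_le1 a b n x; rewrite ger0_norm.
- by [].
Qed.

(* Test functions approximating the indicator functions of boxes show that f
   integrates to 0 on every box inside Om. *)
Lemma fundamental_lemma f : L2 Om f ->
  (forall phi, test_function Om phi -> \int[mu]_(x in Om) (f x * phi x) = 0) ->
  {ae mu, forall x, Om x -> f x = 0}.
Proof.
move=> Lf f0; have iF := L2_integrable Lf.
have f_box a b : closed_box a b `<=` Om -> (\int[mu]_(x in open_box a b) (f x)%:E = 0)%E.
  move=> abO; have tb n := test_function_box_bump n abO.
  have h : (fun n => \int[mu]_(x in Om) (f x * box_bump a b n x)%:E)%E = cst 0%E.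
    apply/funext => n; move: (congr1 EFin (f0 _ (tb n))).
    by rewrite /Rintegral fineK//; apply: integrable_fin_num => //; exact/L2M_integrable/L2_test.
  have := ip_box_bump_cvg Lf abO; rewrite h => /cvg_lim <- //.
  by rewrite lim_cst.
(* Cutting [f] off outside one box turns an integral over any other box into an integral over their
   intersection, again a box inside [Om]. *)
have f_ae a b : closed_box a b `<=` Om -> {ae mu, forall x, open_box a b x -> f x = 0}.
  move=> abO; have mB := measurable_open_box a b.
  have subO : open_box a b `<=` Om by move=> x /open_boxW /abO.
  have ifB : mu.-integrable setT (EFin \o (f \_ (open_box a b))).
    rewrite -restrict_EFin; apply/(integrable_mkcond _ mB); exact: integrableS iF.
  have H (S : set vec) : (\int[mu]_(x in S) ((f \_ (open_box a b)) x)%:E =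
      \int[mu]_(x in S `&` open_box a b) (f x)%:E)%E.
    rewrite integral_mkcondr; apply: eq_integral => x _.
    by rewrite !patchE; case: ifP.
  have := @box_integral_eq0_ae (f \_ (open_box a b)) ifB.
  rewrite H setTI f_box// => /(_ erefl) h.
  have : {ae mu, forall x, (f \_ (open_box a b)) x = 0}.
    apply: h => a' b'; rewrite H setIC open_boxI; apply: f_box.
    move=> x xab; apply: abO => i; have := xab i.
    by rewrite !mxE ge_max le_min => /andP[/andP[-> _] /andP[-> _]].
  by apply: filterS => x + xB; rewrite patchE mem_set.
(* The exceptional set of one rational box; countably many of them cover the points of [Om] where
   [f] is nonzero. *)
pose S (ab : 'rV[rat]_d * 'rV[rat]_d) : set vec :=
  [set x | closed_box (map_mx ratr ab.1) (map_mx ratr ab.2) `<=` Om /\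
           open_box (map_mx ratr ab.1) (map_mx ratr ab.2) x /\ f x <> 0].
have nS ab : mu.-negligible (S ab).
  have [abO|abO] := pselect (closed_box (map_mx ratr ab.1 : vec) (map_mx ratr ab.2) `<=` Om).
    apply: negligibleS (f_ae _ _ abO) => x [_ [xab fx]] /= h; exact/fx/h.
  by rewrite (_ : S ab = set0); [exact: negligible_set0|apply/seteqP; split => // x []].
have : mu.-negligible (\bigcup_ab S ab).
  pose T n := if unpickle n is Some ab then S ab else set0.
  apply: (@negligibleS _ _ _ _ (\bigcup_n T n)); last first.
    apply: negligible_bigcup => n; rewrite /T; case: unpickle => [ab|]; first exact: nS.
    exact: negligible_set0.
  by move=> x [ab _ xS]; exists (pickle ab) => //; rewrite /T pickleK.
apply: negligibleS => x /= /not_implyP[Ox fx].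
by have [ab [xab abO]] := open_box_nbhs oOm Ox; exists ab.
Qed.

End fundamental_lemma.

(** Integrability of the partial sums is carried along because additivity of the integral requires
    it. *)
Lemma Rintegral_sum d (T : measurableType d) (R : realType)
    (mu : {measure set T -> \bar R}) (D : set T) (I : Type) (s : seq I) (F : I -> T -> R) :
  measurable D -> (forall i, mu.-integrable D (EFin \o F i)) ->
  mu.-integrable D (EFin \o (fun x => \sum_(i <- s) F i x)) /\
  \int[mu]_(x in D) (\sum_(i <- s) F i x) = \sum_(i <- s) \int[mu]_(x in D) F i x.
Proof.
move=> mD iF; elim: s => [|i s [ih ihE]].
  split; first by under [X in EFin \o X]eq_fun do rewrite big_nil; exact: integrable0.
  rewrite big_nil; under eq_Rintegral do rewrite big_nil.
  by rewrite Rintegral_cst// mul0r.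
split.
  apply: eq_integrable (integrableD mD (iF i) ih) => // x _ /=.
  by rewrite big_cons EFinD.
rewrite big_cons -ihE -RintegralD//.
by apply: eq_Rintegral => x _; rewrite big_cons.
Qed.

(** Almost everywhere [f] equals its absolute value. *)
Lemma Rintegral_ae_ge0 d (T : measurableType d) (R : realType)
    (mu : {measure set T -> \bar R}) (D : set T) (f : T -> R) :
  measurable D -> measurable_fun D f -> {ae mu, forall x, D x -> 0 <= f x} ->
  0 <= \int[mu]_(x in D) f x.
Proof.
move=> mD mf f0; rewrite (_ : Rintegral _ _ _ = \int[mu]_(x in D) `|f x|).
  by apply: Rintegral_ge0 => x _.
congr fine; apply: ae_eq_integral => //; first exact/measurable_EFinP.
  by apply/measurable_EFinP; exact: measurableT_comp.
by apply: filterS f0 => x h /h f0; rewrite ger0_norm.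
Qed.

Lemma sum_lin (R : comPzRingType) (I : finType) (c : R) (F G H : I -> R) :
  (forall i, F i = c * G i + H i) -> \sum_i F i = c * \sum_i G i + \sum_i H i.
Proof. by move=> E; rewrite (eq_bigr _ (fun i _ => E i)) big_split mulr_sumr. Qed.

Lemma add3_lin (R : comPzRingType) (c s t u s1 t1 u1 s2 t2 u2 : R) :
  s = c * s1 + s2 -> t = c * t1 + t2 -> u = c * u1 + u2 ->
  s + t + u = c * (s1 + t1 + u1) + (s2 + t2 + u2).
Proof. by move=> -> -> ->; ring. Qed.

(** * Weak gradients and the spaces H1 and H10 *)

Section weak_gradient.
Context {R : realType} {d : nat}.
Notation vec := 'rV[R]_d.
Notation mu := (@lebesgue_rV R d).
Variable Om : set vec.
Hypotheses (oOm : open Om) (bOm : bounded_set Om).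
Implicit Types (v w : vec -> R) (g : vec -> vec).

Let mOm : measurable Om. Proof. exact: measurable_open_rV. Qed.

Local Notation ip := (L2_ip Om).
Local Notation L2cvg := (L2_cvg Om).
Local Notation co g j := (fun x => g x ord0 j).

(** The difference of two weak gradients is orthogonal to every test function. *)
Lemma weak_gradient_unique v g g' : is_weak_gradient Om v g ->
  is_weak_gradient Om v g' ->
  forall j, {ae mu, forall x, Om x -> g x ord0 j = g' x ord0 j}.
Proof.
move=> [Lg vg] [Lg' vg'] j.
have : {ae mu, forall x, Om x -> g x ord0 j - g' x ord0 j = 0}.
  apply: (fundamental_lemma oOm bOm); first exact: L2B.
  move=> phi tphi; have Lphi := L2_test oOm bOm tphi.
  rewrite -[LHS]/(ip (fun x => g x ord0 j - g' x ord0 j) phi) ipBl//.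
  apply/eqP; rewrite subr_eq0; apply/eqP/oppr_inj.
  by rewrite /L2_ip -vg// -vg'.
by apply: filterS => x h /h /eqP; rewrite subr_eq0 => /eqP.
Qed.

Lemma is_weak_gradient_lin (c : R) v w g g' : L2 Om v -> L2 Om w ->
  is_weak_gradient Om v g -> is_weak_gradient Om w g' ->
  is_weak_gradient Om (fun x => c * v x + w x) (fun x => c *: g x + g' x).
Proof.
move=> Lv Lw [Lg vg] [Lg' wg']; split=> [j|phi tphi j].
  under eq_fun do rewrite !mxE.
  by apply: L2D => //; exact: L2Z.
have Lphi := L2_test oOm bOm tphi.
have Ldphi := L2_test oOm bOm (test_function_partial j tphi).
rewrite -[LHS]/(ip (fun x => c * v x + w x) (partial j phi)) ipDl ?ipZl//; last exact: L2Z.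
under [in RHS]eq_Rintegral do rewrite !mxE.
rewrite -[in RHS]/(ip (fun x => c * g x ord0 j + g' x ord0 j) phi) ipDl ?ipZl//; last exact: L2Z.
rewrite /L2_ip vg// wg'//; lra.
Qed.

Lemma wgradP v : H1 Om v -> is_weak_gradient Om v (wgrad Om v).
Proof. by move=> [_ [g vg]]; apply: (xgetPex (cst 0)); exists g. Qed.

Lemma wgrad_L2 v j : H1 Om v -> L2 Om (co (wgrad Om v) j).
Proof. by move=> /wgradP[]. Qed.

Lemma fct_linE (c : R) v w : c *: v + w = (fun x => c * v x + w x).
Proof. by []. Qed.

Lemma H1_lin (c : R) v w : H1 Om v -> H1 Om w -> H1 Om (c *: v + w).
Proof.
move=> Hv Hw; split; first by apply: L2D => //; [apply: L2Z => //; exact: Hv.1|exact: Hw.1].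
exists (fun x => c *: wgrad Om v x + wgrad Om w x).
by apply: is_weak_gradient_lin; [exact: Hv.1|exact: Hw.1|exact: wgradP..].
Qed.

Lemma wgrad_lin (c : R) v w j : H1 Om v -> H1 Om w ->
  {ae mu, forall x, Om x -> wgrad Om (c *: v + w) x ord0 j =
     c * wgrad Om v x ord0 j + wgrad Om w x ord0 j}.
Proof.
move=> Hv Hw; have Hvw := wgradP (H1_lin c Hv Hw).
have := weak_gradient_unique Hvw
  (is_weak_gradient_lin c Hv.1 Hw.1 (wgradP Hv) (wgradP Hw)) j.
by apply: filterS => x h /h; rewrite !mxE.
Qed.

Lemma sqr_enorm n (y : 'rV[R]_n) : enorm y ^+ 2 = \sum_j y ord0 j * y ord0 j.
Proof.
rewrite /enorm big_ord1 sqr_sqrtr; last by apply: sumr_ge0 => j _; exact: sqr_ge0.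
by apply: eq_bigr => j _; rewrite expr2.
Qed.

Lemma H1_distE phi v : test_function Om phi -> H1 Om v ->
  \int[mu]_(x in Om) ((phi x - v x) ^+ 2) +
  \int[mu]_(x in Om) (enorm (gradient phi x - wgrad Om v x) ^+ 2) =
  ip (fun x => phi x - v x) (fun x => phi x - v x) +
  \sum_j ip (fun x => partial j phi x - wgrad Om v x ord0 j)
            (fun x => partial j phi x - wgrad Om v x ord0 j).
Proof.
move=> tphi Hv; congr (_ + _).
have L j : L2 Om (fun x => partial j phi x - wgrad Om v x ord0 j).
  apply: L2B => //; last exact: wgrad_L2.
  exact/(L2_test oOm bOm)/test_function_partial.
have [_ <-] := Rintegral_sum (index_enum 'I_d) mOm
  (fun j => L2M_integrable mOm (L j) (L j)).
by apply: eq_Rintegral => x _; rewrite sqr_enorm; apply: eq_bigr => j _; rewrite !mxE.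
Qed.

(** The squared H1 distance is a sum of [d + 1] nonnegative squared L2 distances, so it tends to 0
    exactly when each of them does. *)
Lemma H10P v : H10 Om v <-> H1 Om v /\ exists2 phi : nat -> vec -> R,
  forall n, test_function Om (phi n) &
  L2cvg phi v /\ forall j, L2cvg (fun n => partial j (phi n)) (co (wgrad Om v) j).
Proof.
split=> [[Hv [phi tphi cphi]]|[Hv [phi tphi [cv cg]]]]; split => //; exists phi => //; last first.
  rewrite (eq_cvg _ _ (fun n => H1_distE (tphi n) Hv)).
  have {}cv : ip (fun x => phi n x - v x) (fun x => phi n x - v x) @[n --> \oo] --> (0 : R) := cv.
  suff : ip (fun x => phi n x - v x) (fun x => phi n x - v x) +
    \sum_j ip (fun x => partial j (phi n) x - wgrad Om v x ord0 j)
      (fun x => partial j (phi n) x - wgrad Om v x ord0 j) @[n --> \oo] -->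
    0 + \sum_(j < d) (0 : R) by rewrite big1_eq addr0.
  by apply: cvgD => //; apply: cvg_big => // [|j _]; [exact: add_continuous|exact: cg].
have {}cphi : (fun n => ip (fun x => phi n x - v x) (fun x => phi n x - v x) +
    \sum_j ip (fun x => partial j (phi n) x - wgrad Om v x ord0 j)
            (fun x => partial j (phi n) x - wgrad Om v x ord0 j)) @ \oo --> (0 : R).
  by rewrite -(eq_cvg _ _ (fun n => H1_distE (tphi n) Hv)).
split=> [|j]; apply: squeeze_cvgr (cvg_cst _) cphi; apply: nearW => n; rewrite ip_ge0/=.
  by rewrite lerDl sumr_ge0// => j _; exact: ip_ge0.
rewrite (bigD1 j)//= addrCA lerDl addr_ge0 ?ip_ge0// sumr_ge0// => i _.
exact: ip_ge0.
Qed.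

Lemma L2_ip_lin (c : R) e1 e2 : L2 Om e1 -> L2 Om e2 ->
  ip (fun x => c * e1 x + e2 x) (fun x => c * e1 x + e2 x) =
  c ^+ 2 * ip e1 e1 + 2 * c * ip e1 e2 + ip e2 e2.
Proof.
move=> L1 L2; have cL1 := L2Z mOm c L1; have LL := L2D mOm cL1 L2.
by rewrite ipDl ?ipDr ?ipZl ?ipZr// (ipC _ e2 e1); ring.
Qed.

Lemma L2cvg_lin (c : R) (u1 u2 : nat -> vec -> R) f1 f2 :
  (forall n, L2 Om (u1 n)) -> (forall n, L2 Om (u2 n)) -> L2 Om f1 -> L2 Om f2 ->
  L2cvg u1 f1 -> L2cvg u2 f2 ->
  L2cvg (fun n => c *: u1 n + u2 n) (fun x => c * f1 x + f2 x).
Proof.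
move=> Lu1 Lu2 Lf1 Lf2 cu1 cu2.
have L1 n : L2 Om (fun x => u1 n x - f1 x) by exact: L2B.
have L2' n : L2 Om (fun x => u2 n x - f2 x) by exact: L2B.
have E n : ip (fun x => (c *: u1 n + u2 n) x - (c * f1 x + f2 x))
    (fun x => (c *: u1 n + u2 n) x - (c * f1 x + f2 x)) =
  c ^+ 2 * ip (fun x => u1 n x - f1 x) (fun x => u1 n x - f1 x) +
  2 * c * ip (fun x => u1 n x - f1 x) (fun x => u2 n x - f2 x) +
  ip (fun x => u2 n x - f2 x) (fun x => u2 n x - f2 x).
  rewrite -(L2_ip_lin c (L1 n) (L2' n)); congr L2_ip; apply/funext => x.
    by rewrite !fctE -[c *: _]/(c * _); ring.
  by rewrite !fctE -[c *: _]/(c * _); ring.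
rewrite /L2_cvg (eq_cvg _ _ E).
have c12 : ip (fun x => u1 n x - f1 x) (fun x => u2 n x - f2 x) @[n --> \oo] --> (0 : R).
  apply: (@ip_cvg0 _ _ _ mOm _ _ 1) => //.
  by have /cvgr0Pnorm_le/(_ 1 ltr01) := cu2; apply: filterS => n; exact/le_trans/ler_norm.
suff : c ^+ 2 * ip (fun x => u1 n x - f1 x) (fun x => u1 n x - f1 x) +
  2 * c * ip (fun x => u1 n x - f1 x) (fun x => u2 n x - f2 x) +
  ip (fun x => u2 n x - f2 x) (fun x => u2 n x - f2 x) @[n --> \oo] -->
  c ^+ 2 * 0 + 2 * c * 0 + 0 by rewrite !mulr0 !addr0.
by apply: cvgD => //; apply: cvgD; apply: cvgM => //; exact: cvg_cst.
Qed.

Lemma L2cvg_ae u f f' : (forall n, L2 Om (u n)) -> L2 Om f -> L2 Om f' ->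
  {ae mu, forall x, Om x -> f x = f' x} -> L2cvg u f -> L2cvg u f'.
Proof.
move=> Lu Lf Lf' ff; rewrite /L2_cvg.
have E n : ip (fun x => u n x - f' x) (fun x => u n x - f' x) =
    ip (fun x => u n x - f x) (fun x => u n x - f x).
  by apply: eq_ip => //; try exact: L2B; apply: filterS ff => x h /h ->.
by rewrite (eq_cvg _ _ E).
Qed.

Lemma L2_cvg_Linf c (u : nat -> vec -> R) f : Linf Om c -> (forall n, L2 Om (u n)) ->
  L2 Om f -> L2cvg u f -> L2cvg (fun n x => c x * u n x) (fun x => c x * f x).
Proof.
move=> Lc Lu Lf cu; have [C C0 cC] := Linf_bound Lc.
have L n : L2 Om (fun x => u n x - f x) by exact: L2B.
have E n : ip (fun x => c x * u n x - c x * f x) (fun x => c x * u n x - c x * f x) =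
    ip (fun x => c x * (c x * (u n x - f x))) (fun x => u n x - f x).
  by apply: eq_Rintegral => x _; ring.
rewrite /L2_cvg (eq_cvg _ _ E).
have Lcc n : L2 Om (fun x => c x * (c x * (u n x - f x))) by do 2 apply: L2_Linf => //.
have h n : ip (fun x => c x * (c x * (u n x - f x))) (fun x => u n x - f x) <=
    C ^+ 2 * ip (fun x => u n x - f x) (fun x => u n x - f x).
  rewrite -subr_ge0 -ipZl// -ipBl//; last exact: L2Z.
  have [mc mLn] := (L2_measurable (Lcc n), L2_measurable (L n)).
  apply: Rintegral_ae_ge0 => //.
    apply: measurable_funM => //; apply: measurable_funB => //.
    exact: measurable_funM.
  apply: filterS cC => x cC /cC {}cC; rewrite mulrA -mulrBl -expr2 -mulrA -expr2.
  rewrite mulr_ge0 ?sqr_ge0// subr_ge0 -(real_normK (num_real (c x))).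
  by rewrite ler_pXn2r ?nnegrE.
apply: (@squeeze_cvgr _ _ _ _ (cst 0) (fun n => C ^+ 2 * ip (fun x => u n x - f x) (fun x => u n x - f x))).
- apply: nearW => n; rewrite h andbT -E; exact: ip_ge0.
- exact: cvg_cst.
- have {}cu : ip (fun x => u n x - f x) (fun x => u n x - f x) @[n --> \oo] --> (0 : R) := cu.
  suff : C ^+ 2 * ip (fun x => u n x - f x) (fun x => u n x - f x) @[n --> \oo] -->
    C ^+ 2 * 0 by rewrite mulr0.
  by apply: cvgM => //; exact: cvg_cst.
Qed.

Lemma H10_lin (c : R) v w : H10 Om v -> H10 Om w -> H10 Om (c *: v + w).
Proof.
move=> /H10P[Hv [phi tphi [cv cgv]]] /H10P[Hw [psi tpsi [cw cgw]]].
have Hvw := H1_lin c Hv Hw; apply/H10P; split => //.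
exists (fun n => c *: phi n + psi n).
  by move=> n; apply: test_functionD => //; exact: test_functionZ.
have Lphi n := L2_test oOm bOm (tphi n); have Lpsi n := L2_test oOm bOm (tpsi n).
split=> [|j]; first by apply: L2cvg_lin => //; [exact: Hv.1|exact: Hw.1].
have Ldphi n := L2_test oOm bOm (test_function_partial j (tphi n)).
have Ldpsi n := L2_test oOm bOm (test_function_partial j (tpsi n)).
have E n : partial j (c *: phi n + psi n) = c *: partial j (phi n) + partial j (psi n).
  rewrite (partialD (n := 0))//; [|exact/CkZ/test_Ck|exact: test_Ck].
  by rewrite (partialZ (n := 0))//; exact: test_Ck.
under eq_fun do rewrite E.
have Lv := wgrad_L2 j Hv; have Lw := wgrad_L2 j Hw.
(* Linearity yields the limit c grad v + grad w, which agrees with the chosen gradient of the sum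
   only up to a null set. *)
apply: (@L2cvg_ae _ (fun x => c * wgrad Om v x ord0 j + wgrad Om w x ord0 j)).
- by move=> n; apply: L2D => //; exact: L2Z.
- by apply: L2D => //; exact: L2Z.
- exact: wgrad_L2.
- by apply: filterS (wgrad_lin c j Hv Hw) => x h /h ->.
- exact: L2cvg_lin.
Qed.

Lemma H10_0 : H10 Om 0.
Proof.
have L0 : L2 Om (cst 0) by exact: (L2_test oOm bOm (test_function0 Om)).
have wg0 : is_weak_gradient Om (cst 0) (cst 0).
  split=> [j|phi tphi j]; first by under eq_fun do rewrite mxE.
  rewrite -[LHS]/(ip (cst 0) (partial j phi)).
  under [in RHS]eq_Rintegral do rewrite mxE mul0r.
  rewrite /L2_ip; under eq_Rintegral do rewrite mul0r.
  by rewrite Rintegral_cst// mul0r oppr0.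
have H0 : H1 Om (cst 0) by split => //; exists (cst 0).
apply/H10P; split=> //; exists (fun=> cst 0) => [n|]; first exact: test_function0.
have c0 : L2cvg (fun=> cst 0) (cst 0).
  rewrite /L2_cvg /L2_ip; apply: cvg_near_cst; apply: nearW => n.
  under eq_Rintegral do rewrite subrr mul0r.
  by rewrite Rintegral_cst// mul0r.
split=> // j; rewrite partial_cst; apply: (L2cvg_ae _ _ _ _ c0) => //.
  exact: wgrad_L2.
apply: filterS (weak_gradient_unique wg0 (wgradP H0) j) => x h /h <-.
by rewrite mxE.
Qed.

End weak_gradient.

(** * The form a: bilinearity and coercivity *)

Section bilinear_form.
Context {R : realType} {d : nat}.
Notation vec := 'rV[R]_d.
Notation mu := (@lebesgue_rV R d).
Variable Om : set vec.
Hypotheses (oOm : open Om) (bOm : bounded_set Om).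
Variables (D : vec -> 'M[R]_d) (b : vec -> vec) (reac d0 : R).
Hypotheses (hD : diffusion_tensor Om D d0) (hb : convection_field Om b).
Implicit Types (v w : vec -> R) (g : vec -> vec).

Let mOm : measurable Om. Proof. exact: measurable_open_rV. Qed.

Local Notation ip := (L2_ip Om).

Lemma convection_skew v : H10 Om v ->
  \int[mu]_(x in Om) (dot (b x) (wgrad Om v x) * v x) = 0.
Proof.
move=> /(H10P oOm bOm)[Hv [phi tphi [cv cg]]]; have [Lb divb] := hb.
have Lv := Hv.1; have Lg j := wgrad_L2 j Hv.
have Lphi n := L2_test oOm bOm (tphi n).
have Ldphi j n := L2_test oOm bOm (test_function_partial j (tphi n)).
have Ldot (f g : vec -> R) j : L2 Om f -> L2 Om g ->
  mu.-integrable Om (EFin \o (fun x => b x ord0 j * f x * g x)).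
  by move=> Lf Lg'; apply: L2M_integrable => //; exact: L2_Linf.
rewrite (_ : Rintegral _ _ _ =
    \sum_j ip (fun x => b x ord0 j * wgrad Om v x ord0 j) v); last first.
  have [_ <-] := Rintegral_sum (index_enum 'I_d) mOm (fun j => Ldot _ _ j (Lg j) Lv).
  by apply: eq_Rintegral => x _; rewrite /dot mulr_suml.
have cbg j : L2_cvg Om (fun n x => b x ord0 j * partial j (phi n) x)
    (fun x => b x ord0 j * wgrad Om v x ord0 j).
  exact: L2_cvg_Linf.
have cvg : \sum_j ip (fun x => b x ord0 j * partial j (phi n) x) (phi n) @[n --> \oo] -->
    \sum_j ip (fun x => b x ord0 j * wgrad Om v x ord0 j) v.
  apply: cvg_big => // [|j _]; first exact: add_continuous.
  by apply: cvg_ip => // [n|]; exact: L2_Linf.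
rewrite -(cvg_lim _ cvg)//.
have E n : \sum_j ip (fun x => b x ord0 j * partial j (phi n) x) (phi n) = 0.
  (* The gradient of phi^2 is 2 phi grad phi, so this says that twice the sum is 0. *)
  have := divb _ (test_functionM (tphi n) (tphi n)).
  have [_] := Rintegral_sum (index_enum 'I_d) mOm (fun j => Ldot _ _ j (Ldphi j n) (Lphi n)).
  rewrite /L2_ip => <- E; apply: (@mulfI _ 2) => //; rewrite mulr0 -[RHS]E -RintegralZl//.
    apply: eq_Rintegral => x _; rewrite /dot mulr_sumr; apply: eq_bigr => j _.
    rewrite mxE (partialM (n := 0))//; try exact: test_Ck.
    by rewrite !fctE; ring.
  by have [] := Rintegral_sum (index_enum 'I_d) mOm (fun j => Ldot _ _ j (Ldphi j n) (Lphi n)).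
by under eq_fun do rewrite E; rewrite lim_cst.
Qed.

(** Written with scalar inner products only, the form inherits bilinearity and insensitivity to null
    sets from [L2_ip]. *)
Lemma form_aE w v : H1 Om w -> H1 Om v ->
  form_a Om D b reac w v =
  \sum_i \sum_j ip (fun x => D x i j * wgrad Om w x ord0 j) (fun x => wgrad Om v x ord0 i) +
  \sum_j ip (fun x => b x ord0 j * wgrad Om w x ord0 j) v + reac * ip w v.
Proof.
move=> Hw Hv; have [LD _ _] := hD; have [Lb _] := hb.
have Lw := Hw.1; have Lv := Hv.1.
have Lgw j := wgrad_L2 j Hw; have Lgv j := wgrad_L2 j Hv.
have ID i j := L2M_integrable mOm (L2_Linf mOm (LD i j) (Lgw j)) (Lgv i).
have IDs i := (Rintegral_sum (index_enum 'I_d) mOm (ID i)).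
have Ib j := L2M_integrable mOm (L2_Linf mOm (Lb j) (Lgw j)) Lv.
congr (_ + _ + _).
- have [_] := Rintegral_sum (index_enum 'I_d) mOm (fun i => (IDs i).1).
  rewrite [X in _ = X -> _](eq_bigr _ (fun i _ => (IDs i).2)) => <-.
  apply: eq_Rintegral => x _; rewrite /dot; apply: eq_bigr => i _.
  rewrite mxE mulr_suml; apply: eq_bigr => j _.
  by rewrite mxE (mulrC (D x i j)).
- have [_ <-] := Rintegral_sum (index_enum 'I_d) mOm Ib.
  by apply: eq_Rintegral => x _; rewrite /dot mulr_suml.
- rewrite -RintegralZl//; last exact: L2M_integrable.
  by apply: eq_Rintegral => x _; rewrite mulrA.
Qed.

Lemma form_a_linl (c : R) w w' v : H1 Om w -> H1 Om w' -> H1 Om v ->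
  form_a Om D b reac (c *: w + w') v =
  c * form_a Om D b reac w v + form_a Om D b reac w' v.
Proof.
move=> Hw Hw' Hv; have [LD _ _] := hD; have [Lb _] := hb.
have Hww := H1_lin oOm bOm c Hw Hw'.
have [[Lw Lw'] [Lv Lww]] := ((Hw.1, Hw'.1), (Hv.1, Hww.1)).
have Lgw j := wgrad_L2 j Hw; have Lgw' j := wgrad_L2 j Hw'.
have Lgv j := wgrad_L2 j Hv; have Lgww j := wgrad_L2 j Hww.
rewrite !form_aE//.
have E a j z : Linf Om a -> L2 Om z ->
    ip (fun x => a x * wgrad Om (c *: w + w') x ord0 j) z =
    c * ip (fun x => a x * wgrad Om w x ord0 j) z +
    ip (fun x => a x * wgrad Om w' x ord0 j) z.
  move=> La Lz; have aw := L2_Linf mOm La (Lgw j); have aw' := L2_Linf mOm La (Lgw' j).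
  have aww := L2_Linf mOm La (Lgww j).
  rewrite -ipZl// -ipDl//; last exact: L2Z.
  apply: eq_ip => //; first by apply: L2D => //; exact: L2Z.
    by apply: filterS (wgrad_lin oOm bOm c j Hw Hw') => x h /h ->; ring.
  exact: aeW.
apply: add3_lin.
- by apply: sum_lin => i; apply: sum_lin => j; exact: E.
- by apply: sum_lin => j; exact: E.
- by rewrite (fct_linE c w w') ipDl ?ipZl//; [ring|exact: L2Z].
Qed.

Lemma form_a_linr (c : R) w v v' : H1 Om w -> H1 Om v -> H1 Om v' ->
  form_a Om D b reac w (c *: v + v') =
  c * form_a Om D b reac w v + form_a Om D b reac w v'.
Proof.
move=> Hw Hv Hv'; have [LD _ _] := hD; have [Lb _] := hb.
have Hvv := H1_lin oOm bOm c Hv Hv'.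
have [[Lv Lv'] [Lw Lvv]] := ((Hv.1, Hv'.1), (Hw.1, Hvv.1)).
have Lgv j := wgrad_L2 j Hv; have Lgv' j := wgrad_L2 j Hv'.
have Lgw j := wgrad_L2 j Hw; have Lgvv j := wgrad_L2 j Hvv.
rewrite !form_aE//.
have ED i z : L2 Om z -> ip z (fun x => wgrad Om (c *: v + v') x ord0 i) =
    c * ip z (fun x => wgrad Om v x ord0 i) + ip z (fun x => wgrad Om v' x ord0 i).
  move=> Lz; rewrite -ipZr// -ipDr//; last exact: L2Z.
  apply: eq_ip => //; first by apply: L2D => //; exact: L2Z.
    exact: aeW.
  exact: (wgrad_lin oOm bOm c i Hv Hv').
have Ev z : L2 Om z -> ip z (c *: v + v') = c * ip z v + ip z v'.
  by move=> Lz; rewrite (fct_linE c v v') ipDr ?ipZr//; exact: L2Z.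
apply: add3_lin.
- by apply: sum_lin => i; apply: sum_lin => j; apply: ED; exact: L2_Linf.
- by apply: sum_lin => j; apply: Ev; exact: L2_Linf.
- by rewrite Ev//; ring.
Qed.

(** Convection cancels by [convection_skew] and ellipticity makes the diffusion integrand
    nonnegative almost everywhere; what remains is the reaction term. *)
Lemma form_a_coercive v : 0 <= d0 -> H10 Om v ->
  reac * ip v v <= form_a Om D b reac v v.
Proof.
move=> d00 H10v; have [Hv _] := H10v; have [LD _ Dpos] := hD.
have Lgv j := wgrad_L2 j Hv.
have ID i j := L2M_integrable mOm (L2_Linf mOm (LD i j) (Lgv j)) (Lgv i).
rewrite form_aE//.
have -> : \sum_j ip (fun x => b x ord0 j * wgrad Om v x ord0 j) v = 0.
  rewrite -[RHS](convection_skew H10v).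
  have [_ <-] := Rintegral_sum (index_enum 'I_d) mOm
    (fun j => L2M_integrable mOm (L2_Linf mOm (hb.1 j) (Lgv j)) Hv.1).
  by apply: eq_Rintegral => x _; rewrite /dot mulr_suml.
rewrite addr0 lerDr.
have IDs i := (Rintegral_sum (index_enum 'I_d) mOm (ID i)).
have [ids] := Rintegral_sum (index_enum 'I_d) mOm (fun i => (IDs i).1).
rewrite [X in _ = X -> _](eq_bigr _ (fun i _ => (IDs i).2)) => <-.
apply: Rintegral_ae_ge0 => //; first by apply/measurable_EFinP; exact: measurable_int ids.
apply: filterS Dpos => x /[apply] /(_ (wgrad Om v x)) h.
rewrite (_ : \sum_i _ = \sum_i \sum_j wgrad Om v x ord0 i * D x i j * wgrad Om v x ord0 j).
  by apply: le_trans h; rewrite mulr_ge0// sumr_ge0// => j _; exact: sqr_ge0.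
by apply: eq_bigr => i _; apply: eq_bigr => j _; ring.
Qed.

End bilinear_form.

(** * Polynomials on a cell and traces of their gradients *)

Section local_polynomials.
Context {R : realType} {d : nat}.
Notation vec := 'rV[R]_d.
Implicit Types (K : cell R d) (p q : vec -> R) (x y : vec).

Definition cell_inv K x : vec := (x - origin K) *m invmx (frame K).

Lemma cell_mapK K : frame K \in unitmx -> cancel (cell_map K) (cell_inv K).
Proof. by move=> uK y; rewrite /cell_map /cell_inv addrAC subrr add0r mulmxK. Qed.

Lemma cell_invK K : frame K \in unitmx -> cancel (cell_inv K) (cell_map K).
Proof. by move=> uK x; rewrite /cell_map /cell_inv mulmxKV// addrC subrK. Qed.

Lemma carrierE K : frame K \in unitmx ->
  carrier K = cell_inv K @^-1` ref_cell (simplicial K).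
Proof.
move=> uK; apply/seteqP; split=> [_ [y yK <-]|x xK] /=; first by rewrite cell_mapK.
by exists (cell_inv K x) => //; exact: cell_invK.
Qed.

Lemma cvg_rV (T : Type) (F : set_system T) {FF : Filter F} n (f : T -> 'rV[R]_n) (l : 'rV[R]_n) :
  (forall j, (fun t => f t ord0 j) @ F --> l ord0 j) -> f @ F --> l.
Proof.
move=> fl A [P lP sPA]; apply: (@filterS _ F _ (fun t => forall j, P ord0 j (f t ord0 j))).
  by move=> t tP; apply: sPA => i j; rewrite ord1.
by apply: filter_forall => j; apply: fl; exact: lP.
Qed.

Lemma continuous_affine n m (a : 'rV[R]_m) (M : 'M[R]_(n, m)) (b : 'rV[R]_n) :
  continuous (fun y : 'rV[R]_n => a + (y - b) *m M).
Proof.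
move=> y; apply: (@cvg_rV _ _ (nbhs_filter y)) => j.
pose g (z : 'rV[R]_n) := a ord0 j + \sum_k (z ord0 k - b ord0 k) * M k j.
have E z : (a + (z - b) *m M) ord0 j = g z.
  by rewrite !mxE; congr (_ + _); apply: eq_bigr => k _; rewrite !mxE.
rewrite E (eq_cvg _ _ E); apply: cvgD; first exact: cvg_cst.
apply: cvg_big => // [|k _]; first exact: add_continuous.
apply: cvgM; last exact: cvg_cst.
by apply: cvgB; [exact: coord_continuous|exact: cvg_cst].
Qed.

Lemma continuous_cell_map K : continuous (cell_map K).
Proof.
rewrite (_ : cell_map K = fun y => origin K + (y - 0) *m frame K).
  exact: continuous_affine.
by apply/funext => y; rewrite subr0.
Qed.

Lemma continuous_cell_inv K : continuous (cell_inv K).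
Proof.
rewrite (_ : cell_inv K = fun x => 0 + (x - origin K) *m invmx (frame K)).
  exact: continuous_affine.
by apply/funext => y; rewrite add0r.
Qed.

Lemma Ck_monomial n k (a : {ffun 'I_d -> 'I_k.+1}) (l : 'I_d -> vec -> R) :
  (forall j, Ck n (l j)) -> Ck n (fun x => monomial a (\row_j l j x)).
Proof.
move=> Cl; rewrite (_ : (fun _ => _) = \prod_j l j ^+ a j).
  by apply: Ck_prod => j _; exact: Ck_exp.
apply/funext => x; rewrite fct_prodE; apply: eq_bigr => j _.
by rewrite exprfctE mxE.
Qed.

(** The functions [l j] allow one proof for simplices, where they are the coordinates of [x], and
    for parallelotopes, where they are the reference coordinates. *)
Lemma Ck_Qk n k p (l : 'I_d -> vec -> R) : (forall j, Ck n (l j)) ->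
  Qk k p -> Ck n (fun x => p (\row_j l j x)).
Proof.
move=> Cl [c pE]; rewrite (_ : (fun _ => _) =
    \sum_(a : {ffun 'I_d -> 'I_k.+1}) c a *: (fun x => monomial a (\row_j l j x))).
  by apply: Ck_sum => a _; apply: CkZ; exact: Ck_monomial.
by apply/funext => x; rewrite pE fct_sumE.
Qed.

Lemma Pk_sub_Qk k p : Pk k p -> Qk k p.
Proof.
move=> [c pE]; exists (fun a : {ffun 'I_d -> 'I_k.+1} => if (\sum_j a j <= k)%N then c a else 0) => x.
rewrite pE big_mkcond; apply: eq_bigr => a _; by case: ifP; rewrite ?mul0r.
Qed.

Lemma Ck_local_space n k K p : frame K \in unitmx -> local_space k K p -> Ck n p.
Proof.
rewrite /local_space; case: ifPn => _ uK pP.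
  rewrite (_ : p = fun x => p (\row_j x ord0 j)); last first.
    by apply/funext => x; congr p; apply/rowP => j; rewrite mxE.
  by apply: Ck_Qk (Pk_sub_Qk pP) => j; exact: Ck_coord.
pose l j x := \sum_k (x ord0 k - origin K ord0 k) * invmx (frame K) k j.
rewrite (_ : p = fun x => (p \o cell_map K) (\row_j l j x)); last first.
  apply/funext => x /=; rewrite -{1}(cell_invK uK x); congr (p (cell_map K _)).
  by apply/rowP => j; rewrite !mxE; apply: eq_bigr => i _; rewrite !mxE.
apply: Ck_Qk pP => j.
rewrite (_ : l j = \sum_k (invmx (frame K) k j *: ((fun x : vec => x ord0 k) + cst (- origin K ord0 k)))).
  by apply: Ck_sum => i _; apply: CkZ; apply: CkD; [exact: Ck_coord|exact: Ck_cst].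
by apply/funext => x; rewrite fct_sumE; apply: eq_bigr => i _; rewrite mulrC.
Qed.

Lemma local_space_lin k K (c : R) p q : local_space k K p -> local_space k K q ->
  local_space k K (c *: p + q).
Proof.
rewrite /local_space; case: ifP => _ [a pE] [b qE]; exists (fun i => c * a i + b i) => x.
  rewrite !fctE pE qE -[c *: _]/(c * _) mulr_sumr -big_split; apply: eq_bigr => i _ /=.
  by rewrite mulrDl mulrA.
have := pE x; have := qE x; rewrite /= !fctE => -> ->.
rewrite -[c *: _]/(c * _) mulr_sumr -big_split; apply: eq_bigr => i _ /=.
by rewrite mulrDl mulrA.
Qed.

Lemma local_space0 k K : local_space k K 0.
Proof.
rewrite /local_space; case: ifP => _; exists (fun=> 0) => x.
  by rewrite big1// => a _; rewrite mul0r.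
by rewrite /= big1// => a _; rewrite mul0r.
Qed.

Lemma continuous_sum_coord : continuous (fun y : vec => \sum_j y ord0 j).
Proof.
rewrite (_ : (fun _ => _) = \sum_j (fun y : vec => y ord0 j)).
  apply: (@Ck_continuous _ _ 0); apply: Ck_sum => j _; exact: Ck_coord.
by apply/funext => y; rewrite fct_sumE.
Qed.

Lemma compact_ref_cell b : compact (ref_cell b : set vec).
Proof.
have c01 := @compact_closed_box R d 0 (const_mx 1).
apply: subclosed_compact c01 _; last first.
  case: b => y /=.
    move=> [y0 y1] j; rewrite !mxE y0/= (le_trans _ y1)// (bigD1 j)//= lerDl.
    by apply: sumr_ge0 => i _.
  by move=> h j; rewrite !mxE; exact: h.
case: b; last first.
  rewrite (_ : ref_cell false = closed_box 0 (const_mx 1)); first exact: closed_closed_box.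
  by apply/seteqP; split => y /= h j; have := h j; rewrite !mxE.
have c0 : closed [set y : vec | forall j, 0 <= y ord0 j].
  rewrite (_ : mkset _ = \bigcap_(j in [set: 'I_d])
      ((fun y : vec => y ord0 j) @^-1` [set t | 0 <= t])).
    apply: closed_bigI => j _; apply: closed_comp; last exact: closed_ge.
    by move=> y _; exact: coord_continuous.
  by apply/seteqP; split => y /= h j; [move=> _|]; exact: h.
have c1 : closed [set y : vec | \sum_j y ord0 j <= 1].
  apply: (@closed_comp _ _ (fun y : vec => \sum_j y ord0 j) [set t | t <= 1]); last exact: closed_le.
  by move=> y _; exact: continuous_sum_coord.
exact: closedI c0 c1.
Qed.

Lemma compact_carrier K : compact (carrier K).
Proof.
apply: continuous_compact; last exact: compact_ref_cell.
by apply: continuous_subspaceT; exact: continuous_cell_map.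
Qed.


Definition ref_interior (b : bool) : set vec :=
  if b then [set y | (forall j, 0 < y ord0 j) /\ \sum_j y ord0 j < 1]
  else [set y | forall j, 0 < y ord0 j < 1].

Lemma open_forall_coord (P : set R) : open P -> open [set y : vec | forall j, P (y ord0 j)].
Proof.
move=> oP; rewrite openE => y /= Py; exists (fun _ _ => P) => [i j|z zP j]; last exact: zP.
by rewrite ord1; apply: open_nbhs_nbhs; split.
Qed.

Lemma open_ref_interior b : open (ref_interior b).
Proof.
case: b; last first.
  rewrite (_ : ref_interior false = [set y : vec | forall j, `]0, 1[%classic (y ord0 j)]).
    by apply: open_forall_coord; exact: interval_open.
  by apply/seteqP; split=> y /= h j; have := h j; rewrite /= in_itv.
apply: openI; first by apply: (@open_forall_coord [set t | 0 < t]); exact: open_gt.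
apply: (@open_comp _ _ (fun y : vec => \sum_j y ord0 j) [set t | t < 1]); last exact: open_lt.
by move=> y _; exact: continuous_sum_coord.
Qed.

(** The barycentre of the simplex; it is also interior to the cube, so one point serves both
    shapes. *)
Definition ref_center : vec := const_mx d.+1%:R^-1.

Lemma ref_segment b y (t : R) : ref_cell b y -> 0 < t <= 1 ->
  ref_interior b (y + t *: (ref_center - y)).
Proof.
move=> by_ /andP[t0 t1].
have c0 : 0 < d.+1%:R^-1 :> R by rewrite invr_gt0 ltr0n.
have E j : (y + t *: (ref_center - y)) ord0 j = (1 - t) * y ord0 j + t * d.+1%:R^-1.
  by rewrite !mxE; ring.
case: b by_ => /=.
  move=> [y0 y1]; split=> [j|].
    by rewrite E ltr_wpDl ?mulr_gt0// mulr_ge0// subr_ge0.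
  rewrite (eq_bigr _ (fun j _ => E j)) big_split -mulr_sumr sumr_const card_ord /=.
  have h1 : (1 - t) * (\sum_j y ord0 j) <= 1 - t by rewrite ler_piMr ?subr_ge0.
  have h2 : t / d.+1%:R *+ d < t.
    rewrite -mulr_natr -mulrA gtr_pMr// mulrC ltr_pdivrMr ?ltr0n// mul1r.
    by rewrite ltr_nat.
  by have := ler_ltD h1 h2; rewrite subrK.
move=> h j; rewrite E; have /andP[y0 y1] := h j; apply/andP; split.
  by rewrite ltr_wpDl ?mulr_gt0// mulr_ge0// subr_ge0.
have c1 : d.+1%:R^-1 < 1 :> R.
  by rewrite invf_lt1 ?ltr0n// ltr1n ltnS (leq_ltn_trans _ (ltn_ord j)).
have h1 : (1 - t) * y ord0 j <= 1 - t by rewrite ler_piMr ?subr_ge0.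
have h2 : t / d.+1%:R < t by rewrite gtr_pMr.
by have := ler_ltD h1 h2; rewrite subrK.
Qed.

(** The segment from a point of the cell to the centre enters the interior at once. This makes the
    filter in [gradient_trace] proper up to the facets, hence its limit meaningful. *)
Lemma closure_interior_carrier K x : frame K \in unitmx -> carrier K x ->
  closure (carrier K)° x.
Proof.
move=> uK; rewrite carrierE//= => xK B /= Bx.
pose f (t : R) := cell_map K (cell_inv K x + t *: (ref_center - cell_inv K x)).
have cf : f t @[t --> (0:R)] --> x.
  pose z := (ref_center - cell_inv K x) *m frame K.
  have E t : f t = x + t *: z.
    by rewrite -[X in _ = X + _](cell_invK uK x) /f /cell_map mulmxDl -scalemxAl addrA.
  have : x + t *: z @[t --> (0 : R)] --> x + 0 *: z.
    by apply: cvgD; [exact: cvg_cst|apply: cvgZ; [exact: cvg_id|exact: cvg_cst]].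
  by rewrite scale0r addr0; under eq_fun do rewrite -E.
have /nbhs_ballP[e /= e0 eB] := cf _ Bx.
(* Below [e] to stay in the neighbourhood, at most 1 as [ref_segment] requires. *)
pose t := Num.min 1 (e / 2).
have t0 : 0 < t by rewrite lt_min ltr01 divr_gt0.
have Bt : B (f t).
  apply: eB; rewrite /= /ball /= sub0r normrN gtr0_norm//.
  by rewrite gt_min; apply/orP; right; rewrite ltr_pdivrMr// ltr_pMr// ltr1n.
exists (f t); split => //.
have oU : open (cell_inv K @^-1` ref_interior (simplicial K)).
  apply: open_comp; last exact: open_ref_interior.
  by move=> y _; exact: continuous_cell_inv.
have UK : cell_inv K @^-1` ref_interior (simplicial K) `<=` cell_inv K @^-1` ref_cell (simplicial K).
  move=> y /=; case: (simplicial K) => /= [[h1 h2]|h].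
    by split => [j|]; exact: ltW.
  by move=> j; have /andP[/ltW -> /ltW ->] := h j.
have : (cell_inv K @^-1` ref_interior (simplicial K)) (f t).
  rewrite /= /f cell_mapK//; apply: ref_segment => //.
  by rewrite t0 ge_min lexx.
move=> Uf; apply: filterS UK _.
by apply: open_nbhs_nbhs; split.
Qed.

Lemma continuous_gradient p : Ck 1 p -> continuous (gradient p).
Proof.
move=> Cp x; apply: (@cvg_rV _ _ (nbhs_filter x)) => j.
have E y : gradient p y ord0 j = partial j p y by rewrite mxE.
by rewrite E (eq_cvg _ _ E); exact: (Ck_continuous (@Ck_partial _ _ _ _ j Cp)).
Qed.

(** Around each interior point [v] and [p] coincide, hence so do their gradients, and that of [p] is
    continuous up to [x]. *)
Lemma gradient_traceE K v p x : frame K \in unitmx -> Ck 1 p ->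
  {in carrier K, v =1 p} -> carrier K x ->
  gradient_trace K v x = gradient p x.
Proof.
move=> uK Cp vp Kx; have PF := within_nbhs_proper (closure_interior_carrier uK Kx).
apply: cvg_lim; first exact: norm_hausdorff.
have cp : gradient p @ within (carrier K)° (nbhs x) --> gradient p x.
  by apply: cvg_within_filter; exact: continuous_gradient.
apply: cvg_trans cp; apply: near_eq_cvg; rewrite near_withinE.
apply: nearW => y Ky; apply/rowP => j; rewrite !mxE /partial.
apply: near_eq_derive; apply: filterS Ky => z Kz.
by apply/esym/vp; rewrite inE.
Qed.

End local_polynomials.

(** * Charts of facets and facet integrals *)

Section facet_charts.
Context {R : realType} {d : nat}.
Notation vec := 'rV[R]_d.
Notation lam := (@lebesgue_rV R d.-1).
Implicit Types (K : cell R d) (F : set vec) (g : vec -> R).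

(** The rows of [B] are a basis of the kernel of [w], of dimension d - 1 by rank-nullity. *)
Lemma hyperplane_basis (w : 'cV[R]_d) : w != 0 ->
  exists2 B : 'M[R]_(d.-1, d), row_free B &
    forall u : vec, u *m w = 0 -> exists y, u = y *m B.
Proof.
move=> w0; have rw : \rank w = 1%N.
  by apply/eqP; rewrite eqn_leq rank_leq_col lt0n mxrank_eq0.
have rk : \rank (kermx w) = d.-1 by rewrite mxrank_ker rw subn1.
have := row_base_free (kermx w); have := eq_row_base (kermx w).
move: (row_base (kermx w)); rewrite rk => B BE fB; exists B => // u /eqP uw.
by apply/submxP; rewrite BE -sub_kermx in uw *.
Qed.

Lemma ref_facet_hyperplane b (G : set vec) : ref_facets b G ->
  (0 < d)%N -> exists (w : 'cV[R]_d) (c : 'M[R]_1), w != 0 /\ forall y, G y -> y *m w = c.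
Proof.
move=> bG d0; pose i0 := Ordinal d0.
have dn0 j : delta_mx j ord0 != 0 :> 'cV[R]_d.
  by apply/eqP => /matrixP/(_ j ord0)/eqP; rewrite !mxE !eqxx oner_eq0.
have dE (y : vec) j : y *m delta_mx j ord0 = (y ord0 j)%:M.
  by rewrite -colE; apply/matrixP => a b'; rewrite !ord1 !mxE eqxx mulr1n.
case: bG => [[j ->]|].
  by exists (delta_mx j ord0), 0%:M; split => // y [_ yj]; rewrite dE yj.
case: b => [->|[j ->]].
  exists (const_mx 1), 1%:M; split.
    by apply/eqP => /matrixP/(_ i0 ord0)/eqP; rewrite !mxE oner_eq0.
  move=> y [_ y1]; apply/matrixP => a b'; rewrite !ord1 !mxE eqxx mulr1n -[RHS]y1.
  by apply: eq_bigr => j _; rewrite mxE mulr1.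
by exists (delta_mx j ord0), 1%:M; split => // y [_ yj]; rewrite dE yj.
Qed.

(** A chart exists, so [chart F] is not the default value of [xget]. *)
Lemma is_chart_facet K F : (0 < d)%N -> frame K \in unitmx -> facets K F ->
  is_chart F (chart F).
Proof.
move=> d0 uK [G bG FE]; apply: (xgetPex (0, 0)).
have [w [c [w0 Gw]]] := ref_facet_hyperplane bG d0.
(* The normal of the reference facet, transported by the frame, is normal to the image facet. *)
have nu0 : invmx (frame K) *m w != 0.
  apply: contra w0 => /eqP h; apply/eqP.
  by rewrite -(mulKVmx uK w) h mulmx0.
have [B fB BP] := hyperplane_basis nu0.
(* The chart is based at a point of the facet; if there is none, any base point will do. *)
have [[y0 Gy0]|nG] := pselect (exists y, G y); last first.
  exists (0, B); split => //= x; rewrite -FE => -[y Gy _].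
  by exfalso; apply: nG; exists y.
exists (cell_map K y0, B); split => //= x; rewrite -FE => -[y Gy <-].
have [|z zE] := BP (cell_map K y - cell_map K y0).
  rewrite /cell_map opprD addrACA subrr add0r -mulmxBl -mulmxA (mulmxA (frame K)).
  by rewrite mulmxV// mul1mx mulmxBl !Gw// subrr.
by exists z => //; rewrite -zE addrC subrK.
Qed.

Lemma continuous_chart_map F : continuous (chart_map F).
Proof.
rewrite (_ : chart_map F = fun y => (chart F).1 + (y - 0) *m (chart F).2).
  exact: continuous_affine.
by apply/funext => y; rewrite subr0.
Qed.

(** A right inverse of the chart matrix recovers the parameter continuously from the point, so the
    preimage is bounded. *)
Lemma compact_chart_preimage F : compact F -> row_free (chart F).2 ->
  compact (chart_map F @^-1` F).
Proof.
move=> cF /row_freeP[B BE]; apply/compact_rV; split; last first.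
  apply: closed_comp; first by move=> y _; exact: continuous_chart_map.
  by apply: compact_closed cF; exact: norm_hausdorff.
pose f (x : vec) := 0 + (x - (chart F).1) *m B.
apply: (@bounded_sub_rV _ _ _ (f @` F)).
  move=> y Fy; exists (chart_map F y) => //.
  by rewrite /f /chart_map addrAC subrr !add0r -mulmxA BE mulmx1.
apply: compact_bounded; apply: continuous_compact cF.
by apply: continuous_subspaceT; exact: continuous_affine.
Qed.

Lemma facet_integrable F g : compact F -> row_free (chart F).2 -> continuous g ->
  lam.-integrable (chart_map F @^-1` F) (EFin \o (fun y => g (chart_map F y))).
Proof.
move=> cF fF cg; have cP := compact_chart_preimage cF fF.
have [bP clP] := (compact_rV _).1 cP; have mP := measurable_closed_rV clP.
have cgc : continuous (fun y => g (chart_map F y)).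
  by move=> y; apply: continuous_comp; [exact: continuous_chart_map|exact: cg].
apply: measurable_bounded_integrable => //.
- exact: lebesgue_rV_fin.
- exact: continuous_measurable_rV.
have : compact ((fun y => g (chart_map F y)) @` (chart_map F @^-1` F)).
  by apply: continuous_compact => //; exact: continuous_subspaceT.
move=> /compact_bounded[M [Mr h]]; exists M; split => // A MA y Fy /=.
by apply: (h _ MA); exists y.
Qed.

(** Gradient jumps are controlled on the facet only; the continuous [G1] and [G2], equal to the
    integrands there, supply integrability. *)
Lemma facet_integral_lin F (c : R) g g1 g2 G1 G2 : compact F -> row_free (chart F).2 ->
  continuous G1 -> continuous G2 ->
  (forall x, F x -> g x = c * g1 x + g2 x) ->
  (forall x, F x -> g1 x = G1 x) -> (forall x, F x -> g2 x = G2 x) ->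
  facet_integral F g = c * facet_integral F g1 + facet_integral F g2.
Proof.
move=> cF fF cG1 cG2 gE g1E g2E; rewrite /facet_integral.
have mP : measurable (chart_map F @^-1` F).
  by apply: measurable_closed_rV; have [] := (compact_rV _).1 (compact_chart_preimage cF fF).
have i1 := facet_integrable cF fF cG1; have i2 := facet_integrable cF fF cG2.
rewrite mulrCA -mulrDr; congr (_ * _).
have -> : \int[lam]_(y in chart_map F @^-1` F) g1 (chart_map F y) =
    \int[lam]_(y in chart_map F @^-1` F) G1 (chart_map F y).
  by apply: eq_Rintegral => y; rewrite inE; exact: g1E.
have -> : \int[lam]_(y in chart_map F @^-1` F) g2 (chart_map F y) =
    \int[lam]_(y in chart_map F @^-1` F) G2 (chart_map F y).
  by apply: eq_Rintegral => y; rewrite inE; exact: g2E.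
rewrite -RintegralZl// -RintegralD//; last first.
  by apply: eq_integrable (integrableZl mP c i1) => // y _ /=; rewrite EFinM.
by apply: eq_Rintegral => y; rewrite inE => Fy; rewrite gE// g1E// g2E.
Qed.

Lemma facet_integral_ge0 F g : (forall x, F x -> 0 <= g x) -> 0 <= facet_integral F g.
Proof.
by move=> g0; apply: mulr_ge0; [exact: sqrtr_ge0|apply: Rintegral_ge0 => y; exact: g0].
Qed.

End facet_charts.

(** * The jump form J *)

Section jump_form.
Context {R : realType} {d m k : nat}.
Notation vec := 'rV[R]_d.
Hypothesis d0 : (0 < d)%N.
Variables (K : 'I_m -> cell R d).
Hypothesis uK : forall i, frame (K i) \in unitmx.
Variables (b : vec -> vec) (gamma : R).
Implicit Types (u v w : vec -> R).

Definition piecewise_poly v : Prop := forall i,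
  exists2 p, local_space k (K i) p & {in carrier (K i), v =1 p}.

Lemma piecewise_poly_lin (c : R) v w : piecewise_poly v -> piecewise_poly w ->
  piecewise_poly (c *: v + w).
Proof.
move=> pv pw i; have [p lp vp] := pv i; have [q lq wq] := pw i.
exists (c *: p + q); first exact: local_space_lin.
by move=> x xK; rewrite !fctE vp// wq.
Qed.

Lemma dotZl n (c : R) (x y z : 'rV[R]_n) : dot (c *: x + y) z = c * dot x z + dot y z.
Proof.
by rewrite /dot mulr_sumr -big_split; apply: eq_bigr => j _; rewrite !mxE mulrDl mulrA.
Qed.

Lemma dotC n (x y : 'rV[R]_n) : dot x y = dot y x.
Proof. by apply: eq_bigr => j _; rewrite mulrC. Qed.

Lemma dot_ge0 n (x : 'rV[R]_n) : 0 <= dot x x.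
Proof. by apply: sumr_ge0 => j _; rewrite -expr2 sqr_ge0. Qed.

Lemma gradient_trace_lin i (c : R) v w x : piecewise_poly v -> piecewise_poly w ->
  carrier (K i) x ->
  gradient_trace (K i) (c *: v + w) x =
  c *: gradient_trace (K i) v x + gradient_trace (K i) w x.
Proof.
move=> pv pw xK; have [p lp vp] := pv i; have [q lq wq] := pw i.
have Cp := Ck_local_space 1 (uK i) lp; have Cq := Ck_local_space 1 (uK i) lq.
rewrite (gradient_traceE (uK i) Cp vp xK) (gradient_traceE (uK i) Cq wq xK).
have Ccp := CkZ c Cp; have Cpq := CkD Ccp Cq.
have vpq : {in carrier (K i), c *: v + w =1 c *: p + q}.
  by move=> y yK; rewrite !fctE vp// wq.
rewrite (gradient_traceE (uK i) Cpq vpq xK).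
apply/rowP => j; rewrite !mxE (partialD _ Ccp Cq) (partialZ _ _ Cp).
by rewrite !fctE.
Qed.

Lemma gradient_jump_lin i j (c : R) v w x : piecewise_poly v -> piecewise_poly w ->
  (carrier (K i) `&` carrier (K j)) x ->
  gradient_jump (K i) (K j) (c *: v + w) x =
  c *: gradient_jump (K i) (K j) v x + gradient_jump (K i) (K j) w x.
Proof.
move=> pv pw [xi xj]; rewrite /gradient_jump (gradient_trace_lin c pv pw xi) (gradient_trace_lin c pv pw xj).
have E (a a' z z' : vec) : c *: a + a' - (c *: z + z') = c *: (a - z) + (a' - z').
  by rewrite scalerBr opprD addrACA.
exact: E.
Qed.

(** On the common part of two cells a jump is the difference of the gradients of two polynomials,
    which are continuous everywhere. *)
Lemma gradient_jump_dot i j v w : piecewise_poly v -> piecewise_poly w ->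
  exists2 G : vec -> R, continuous G & forall x, (carrier (K i) `&` carrier (K j)) x ->
    dot (gradient_jump (K i) (K j) v x) (gradient_jump (K i) (K j) w x) = G x.
Proof.
move=> pv pw; have [p lp vp] := pv i; have [q lq wq] := pw i.
have [p' lp' vp'] := pv j; have [q' lq' wq'] := pw j.
have C1 l (f : vec -> R) : local_space k (K l) f -> Ck 1 f by exact: Ck_local_space.
exists (\sum_l (partial l p + (-1) *: partial l p') * (partial l q + (-1) *: partial l q')).
  have Cd (f : vec -> R) l : Ck 1 f -> Ck 0 (partial l f) by exact: Ck_partial.
  apply: (@Ck_continuous _ _ 0); apply: Ck_sum => l _.
  apply: CkM; apply: CkD; try apply: CkZ; apply: Cd.
  - exact: C1 lp.
  - exact: C1 lp'.
  - exact: C1 lq.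
  - exact: C1 lq'.
move=> x [xi xj]; rewrite /gradient_jump.
rewrite (gradient_traceE (uK i) (C1 _ _ lp) vp xi) (gradient_traceE (uK j) (C1 _ _ lp') vp' xj).
rewrite (gradient_traceE (uK i) (C1 _ _ lq) wq xi) (gradient_traceE (uK j) (C1 _ _ lq') wq' xj).
rewrite fct_sumE; apply: eq_bigr => l _; rewrite !mxE !fctE.
by rewrite -![_ *: _]/(_ * _) !mulN1r.
Qed.

Lemma form_J_linl (c : R) u u' v :
  piecewise_poly u -> piecewise_poly u' -> piecewise_poly v ->
  form_J K b gamma (c *: u + u') v = c * form_J K b gamma u v + form_J K b gamma u' v.
Proof.
move=> pu pu' pv; rewrite /form_J mulrCA -mulrDr; congr (_ * _).
apply: sum_lin => i; rewrite mulr_sumr -big_split; apply: eq_bigr => j /andP[_].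
move=> /asboolP[Fi _]; set F := carrier (K i) `&` carrier (K j) in Fi *.
have [fF _] := is_chart_facet d0 (uK i) Fi.
have cF : compact F.
  apply: compact_closedI; first exact: compact_carrier.
  by apply: compact_closed; [exact: norm_hausdorff|exact: compact_carrier].
have [G1 cG1 G1E] := gradient_jump_dot i j pu pv.
have [G2 cG2 G2E] := gradient_jump_dot i j pu' pv.
set C := fine _ * _; have cst_cont (G : vec -> R) : continuous G -> continuous (fun x => C * G x).
  
  by move=> cG; apply: (@Ck_continuous _ _ 0 (C *: G)); apply: CkZ.
apply: (facet_integral_lin cF fF (cst_cont _ cG1) (cst_cont _ cG2)) => x Fx.
- have mul_lin (X Y Z : R) : X = c * Y + Z -> C * X = c * (C * Y) + C * Z by move=> ->; ring.
  apply: mul_lin; rewrite (gradient_jump_lin c pu pu' Fx); exact: dotZl.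
- exact: (congr1 ( *%R C) (G1E x Fx)).
- exact: (congr1 ( *%R C) (G2E x Fx)).
Qed.

(** Turns linearity in the first argument into linearity in the second. *)
Lemma form_JC u v : form_J K b gamma u v = form_J K b gamma v u.
Proof.
have E i j x : dot (gradient_jump (K i) (K j) u x) (gradient_jump (K i) (K j) v x) =
    dot (gradient_jump (K i) (K j) v x) (gradient_jump (K i) (K j) u x).
  exact: dotC.
have E' i j (C : R) (F : set vec) := congr1 (facet_integral F)
  (funext (fun x => congr1 ( *%R C) (E i j x))).
exact: (congr1 ( *%R gamma) (eq_bigr _ (fun i _ => eq_bigr _ (fun j _ => E' i j _ _)))).
Qed.

Lemma form_J_ge0 v : 0 <= gamma -> 0 <= form_J K b gamma v v.
Proof.
move=> g0; apply: mulr_ge0 => //; apply: sumr_ge0 => i _; apply: sumr_ge0 => j _ /=.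
apply: facet_integral_ge0 => x _; rewrite mulr_ge0 ?dot_ge0// mulr_ge0 ?sqr_ge0//.
by rewrite fine_ge0// Lnorm_ge0.
Qed.

End jump_form.

(** * Positivity of the mesh function *)

Section mesh_function.
Context {R : realType} {d : nat}.
Notation vec := 'rV[R]_d.
Implicit Types (K : cell R d) (p q : vec -> R) (y : vec).

Lemma convex_sum_gt0 (I : finType) (w A : I -> R) : (forall i, 0 <= w i) ->
  \sum_i w i = 1 -> (forall i, 0 < A i) -> 0 < \sum_i w i * A i.
Proof.
move=> w0 w1 A0; have wA i : 0 <= w i * A i by rewrite mulr_ge0// ltW.
rewrite lt_neqAle sumr_ge0// andbT eq_sym; apply/eqP => /eqP.
rewrite psumr_eq0// => /allP wA0; have := oner_neq0 R; rewrite -w1 big1 ?eqxx// => i _.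
have := wA0 i (mem_index_enum _); rewrite /= mulf_eq0 (gt_eqF (A0 i)) orbF.
by move/eqP.
Qed.

(** With exponents 0 or 1 each factor is affine in its coordinate, hence interpolated from its
    values at 0 and 1. Distributing the product over these sums enumerates the corners [e] of the
    cube. *)
Lemma monomial1_multilinear (a : {ffun 'I_d -> 'I_2}) y :
  monomial a y = \sum_(e : {ffun 'I_d -> bool})
    (\prod_j (if e j then y ord0 j else 1 - y ord0 j)) * monomial a (\row_j (e j)%:R).
Proof.
have E j : y ord0 j ^+ a j =
    \sum_(e : bool) (if e then y ord0 j else 1 - y ord0 j) * e%:R ^+ a j.
  rewrite big_bool /= expr1n mulr1.
  by case: (a j) => -[|[|//]] i /=; rewrite ?expr0 ?expr1 ?expr0n /=; ring.
rewrite /monomial (eq_bigr _ (fun j _ => E j)) bigA_distr_bigA /=.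
apply: eq_bigr => e _; rewrite -big_split; apply: eq_bigr => j _ /=.
by rewrite mxE.
Qed.

Lemma Qk1_multilinear q y : Qk 1 q ->
  q y = \sum_(e : {ffun 'I_d -> bool})
    (\prod_j (if e j then y ord0 j else 1 - y ord0 j)) * q (\row_j (e j)%:R).
Proof.
move=> [c qE]; rewrite qE (eq_bigr (fun a => \sum_(e : {ffun 'I_d -> bool})
   (\prod_j (if e j then y ord0 j else 1 - y ord0 j)) * (c a * monomial a (\row_j (e j)%:R)))).
  by rewrite exchange_big; apply: eq_bigr => e _; rewrite qE mulr_sumr.
move=> a _; rewrite monomial1_multilinear mulr_sumr; apply: eq_bigr => e _.
by rewrite mulrCA.
Qed.

Lemma multilinear_weights y :
  \sum_(e : {ffun 'I_d -> bool}) (\prod_j (if e j then y ord0 j else 1 - y ord0 j)) = 1.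
Proof.
rewrite -(bigA_distr_bigA (fun j (e : bool) => if e then y ord0 j else 1 - y ord0 j)) /=.
by apply: big1 => j _; rewrite big_bool /= addrC subrK.
Qed.

(** A monomial of total degree at most 1 is either 1 or a single coordinate, and barycentric
    interpolation reproduces both. *)
Lemma monomial_affine (a : {ffun 'I_d -> 'I_2}) (o : vec) (M : 'M[R]_d) y :
  (\sum_j a j <= 1)%N ->
  monomial a (o + y *m M) = (1 - \sum_j y ord0 j) * monomial a o +
    \sum_j y ord0 j * monomial a (o + row j M).
Proof.
move=> a1; have [a0|/existsP[l al]] := boolP [forall l, a l == ord0].
  have E (z : vec) : monomial a z = 1.
    by apply: big1 => l _; rewrite (eqP (forallP a0 l)).
  have -> : \sum_j y ord0 j * monomial a (o + row j M) = \sum_j y ord0 j.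
    by apply: eq_bigr => j _; rewrite E mulr1.
  by rewrite !E mulr1 subrK.
have al1 : a l = 1%N :> nat.
  by case: (a l) al => -[|[|//]] i.
have a0 j : j != l -> a j = 0%N :> nat.
  move=> jl; move: a1; rewrite (bigD1 l)//= (bigD1 j)//= al1.
  by case: (nat_of_ord (a j)).
have E (z : vec) : monomial a z = z ord0 l.
  by rewrite /monomial (bigD1 l)//= al1 big1 ?mulr1// => j /a0 ->.
have -> : \sum_j y ord0 j * monomial a (o + row j M) =
    \sum_j (y ord0 j * o ord0 l + y ord0 j * M j l).
  by apply: eq_bigr => j _; rewrite E !mxE mulrDr.
rewrite !E !mxE big_split -mulr_suml /=; ring.
Qed.

Lemma Pk1_affine p (o : vec) (M : 'M[R]_d) y : Pk 1 p ->
  p (o + y *m M) = (1 - \sum_j y ord0 j) * p o + \sum_j y ord0 j * p (o + row j M).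
Proof.
move=> [c pE].
have -> : \sum_j y ord0 j * p (o + row j M) =
    \sum_j \sum_(a : {ffun 'I_d -> 'I_2} | (\sum_j a j <= 1)%N)
    y ord0 j * (c a * monomial a (o + row j M)).
  by apply: eq_bigr => j _; rewrite pE mulr_sumr.
rewrite !pE exchange_big mulr_sumr -big_split; apply: eq_bigr => a a1 /=.
rewrite monomial_affine// mulrDr mulrCA; congr (_ + _).
by rewrite mulr_sumr; apply: eq_bigr => j _; rewrite mulrCA.
Qed.

Lemma ref_vertex_lattice K y : ref_cell (simplicial K) y ->
  (forall j, exists n : nat, y ord0 j = n%:R) -> vertices K (cell_map K y).
Proof.
by move=> yK yn; exists y => //; split=> // j; have [n ->] := yn j; exists n; rewrite divr1.
Qed.

Lemma vertex_origin K : vertices K (origin K).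
Proof.
have -> : origin K = cell_map K 0 by rewrite /cell_map mul0mx addr0.
apply: ref_vertex_lattice => [|j]; last by exists 0%N; rewrite mxE.
case: (simplicial K) => /= [|j]; last by rewrite mxE lexx ler01.
split=> [j|]; first by rewrite mxE.
by rewrite big1// => j _; rewrite mxE.
Qed.

Lemma delta_rV_natE (i j : 'I_d) : (delta_mx ord0 i : vec) ord0 j = (j == i)%:R.
Proof. by rewrite mxE eqxx. Qed.

Lemma vertex_row K i : vertices K (origin K + row i (frame K)).
Proof.
have -> : origin K + row i (frame K) = cell_map K (delta_mx ord0 i).
  by rewrite /cell_map -rowE.
apply: ref_vertex_lattice => [|j]; last by exists (j == i); rewrite delta_rV_natE.
case: (simplicial K) => /= [|j]; last by rewrite delta_rV_natE ler0n lern1 leq_b1.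
split=> [j|]; first by rewrite delta_rV_natE.
by rewrite (bigD1 i)//= delta_rV_natE eqxx big1 ?addr0// => j /negbTE; rewrite delta_rV_natE => ->.
Qed.

Lemma vertices_sub_carrier K : vertices K `<=` carrier K.
Proof. by move=> _ [y [yK _] <-]; exists y. Qed.

Lemma local_space1_gt0 K p : local_space 1 K p -> (forall v, vertices K v -> 0 < p v) ->
  forall x, carrier K x -> 0 < p x.
Proof.
move=> + pv _ [y yK <-]; rewrite /local_space; case: ifPn yK => simpK yK pP; last first.
  have := Qk1_multilinear y pP; rewrite /= => ->; apply: convex_sum_gt0 => [e||e].
  - apply: prodr_ge0 => j _; have /andP[y0 y1] := yK j.
    by case: ifP => // _; rewrite subr_ge0.
  - exact: multilinear_weights.
  - apply: pv; apply: ref_vertex_lattice => [|j]; last by exists (e j); rewrite mxE.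
    by rewrite (negbTE simpK) => j; rewrite mxE ler0n lern1 leq_b1.
rewrite /cell_map Pk1_affine//; have [y0 y1] := yK.
have p0 := pv _ (vertex_origin K); have pr i := pv _ (vertex_row K i).
have S0 : 0 <= \sum_j y ord0 j * p (origin K + row j (frame K)).
  by apply: sumr_ge0 => j _; rewrite mulr_ge0// ltW.
(* If the coordinates sum to 1 the weight of the origin vertex vanishes, and the other weights form
   a convex combination by themselves. *)
move: y1; rewrite le_eqVlt => /predU1P[y1|y1]; last first.
  by rewrite ltr_wpDr// mulr_gt0// subr_gt0.
by rewrite y1 subrr mul0r add0r; exact: convex_sum_gt0.
Qed.

Lemma enorm_gt0 n (y : 'rV[R]_n) : y != 0 -> 0 < enorm y.
Proof.
move=> y0; rewrite sqrtr_gt0 big_ord1.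
have [j yj] : exists j, y ord0 j != 0.
  apply: contrapT => h; move/eqP: y0; apply; apply/rowP => j; rewrite mxE.
  by apply/eqP; apply: contrapT => /negP yj; apply: h; exists j.
rewrite (bigD1 j)//= ltr_pwDl ?exprn_even_gt0// sumr_ge0// => i _.
exact: sqr_ge0.
Qed.

Lemma enorm_le n (y : 'rV[R]_n) (M : R) : (forall j, `|y ord0 j| <= M) ->
  enorm y <= Num.sqrt (M ^+ 2 *+ n).
Proof.
move=> yM; rewrite ler_wsqrtr// big_ord1.
have -> : M ^+ 2 *+ n = \sum_(j < n) M ^+ 2 by rewrite sumr_const card_ord.
apply: ler_sum => j _; rewrite -real_normK ?num_real//.
by rewrite ler_pXn2r ?nnegrE// (le_trans _ (yM j)).
Qed.

Lemma diam_gt0 (G : set vec) (x y : vec) : bounded_set G -> G x -> G y -> x != y ->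
  0 < diam G.
Proof.
move=> bG Gx Gy xy; have [M GM] := bounded_sub_closed_box bG.
apply: (@lt_le_trans _ _ (enorm (x - y))); first by rewrite enorm_gt0// subr_eq0.
(* [sup] dominates a member only if the distances are bounded; in a box of half-width [M] each
   coordinate of a difference is at most [M + M]. *)
apply: ub_le_sup; last by exists (x, y).
exists (Num.sqrt ((M + M) ^+ 2 *+ d)) => _ [[a b] [/= /GM Ga /GM Gb] <-].
apply: enorm_le => j; have := Ga j; have := Gb j; rewrite !mxE -!ler_norml => b1 a1.
by rewrite (le_trans (ler_normB _ _))// lerD.
Qed.

Lemma diam_carrier_gt0 K : (0 < d)%N -> frame K \in unitmx -> 0 < diam (carrier K).
Proof.
move=> d0 uK; pose i := Ordinal d0.
apply: (@diam_gt0 _ (origin K) (origin K + row i (frame K))).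
- by have [] := (compact_rV _).1 (@compact_carrier R d K).
- exact/vertices_sub_carrier/vertex_origin.
- exact/vertices_sub_carrier/vertex_row.
apply/eqP => /eqP; rewrite -subr_eq0 opprD addNKr oppr_eq0 rowE => /eqP h.
have := mulmxK uK (delta_mx ord0 i : vec); rewrite h mul0mx => /rowP/(_ i)/eqP.
by rewrite delta_rV_natE mxE eqxx eq_sym oner_eq0.
Qed.

Lemma mesh_function_gt0 m (Om : set vec) (K : 'I_m -> cell R d) (h : vec -> R) :
  (0 < d)%N -> (forall i, frame (K i) \in unitmx) -> is_mesh_function Om K h ->
  forall i x, carrier (K i) x -> 0 < h x.
Proof.
move=> d0 uK [_ hP hv] i x xK; have [p lp hp] := hP i.
rewrite hp ?inE//; apply: local_space1_gt0 lp _ x xK => v vK.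
have Kv := vertices_sub_carrier vK; rewrite -hp ?inE// (hv i v vK) divr_gt0//.
  rewrite (bigD1 i) ?inE//= ltr_pwDl ?diam_carrier_gt0// sumr_ge0// => j _.
  exact/ltW/diam_carrier_gt0.
by rewrite ltr0n; apply/card_gt0P; exists i; rewrite !inE.
Qed.

End mesh_function.

(** * Truncation of a real number to [0, kappa] *)

Section clamp.
Context {R : realType}.
Implicit Types (a b w r t kappa : R).

Definition clamp kappa a : R := Num.max 0 (Num.min a kappa).

Lemma clampP kappa a : 0 < kappa ->
  [\/ a <= 0 /\ clamp kappa a = 0, 0 <= a <= kappa /\ clamp kappa a = a |
      kappa <= a /\ clamp kappa a = kappa].
Proof.
move=> k0; have [a0|a0] := leP a 0.
  by apply: Or31; rewrite /clamp min_l ?max_l// (le_trans a0)// ltW.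
have [ak|/ltW ak] := leP a kappa.
  by apply: Or32; rewrite /clamp min_l// max_r ?(ltW a0).
by apply: Or33; rewrite /clamp min_r// max_r// ltW.
Qed.

Lemma clamp_itv kappa a : 0 < kappa -> 0 <= clamp kappa a <= kappa.
Proof. by move=> k0; case: (clampP a k0) => -[? ->] //; lra. Qed.

Lemma clamp_dist kappa a b : 0 < kappa -> `|clamp kappa a - clamp kappa b| <= `|a - b|.
Proof.
move=> k0; wlog ab : a b / a <= b => [H|].
  have [/H//|/ltW/H] := leP a b.
  by rewrite (distrC (clamp _ b)) (distrC b).
rewrite (distrC a) (distrC (clamp _ a)) (ger0_norm (_ : 0 <= b - a)) ?subr_ge0//.
rewrite ler_norml; apply/andP.
by split; case: (clampP a k0) => -[? ->]; case: (clampP b k0) => -[? ->]; lra.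
Qed.

(** Both [clamp kappa a] and [a - clamp kappa a] are nondecreasing in [a], so the two increments
    never have opposite signs. *)
Lemma clamp_monotone kappa a b : 0 < kappa ->
  0 <= (clamp kappa a - clamp kappa b) * ((a - clamp kappa a) - (b - clamp kappa b)).
Proof.
by move=> k0; case: (clampP a k0) => -[? ->]; case: (clampP b k0) => -[? ->]; nra.
Qed.

(** The hypothesis puts [r] in the normal cone of the interval at [w]: it is <= 0 at the end 0, >= 0
    at the end kappa, and 0 in between. The factor [t] does not affect this. *)
Lemma clamp_scale kappa w r t : 0 < kappa -> 0 < t ->
  clamp kappa (w + t * r) = w -> clamp kappa (w + r) = w.
Proof.
move=> k0 t0; have [r0|r0|->] := ltrgtP r 0; last by rewrite mulr0.
- have : t * r < 0 by rewrite pmulr_rlt0.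
  by move: (t * r) => y y0; case: (clampP (w + y) k0) => -[? ->];
    case: (clampP (w + r) k0) => -[? ->]; lra.
- have : 0 < t * r by rewrite mulr_gt0.
  by move: (t * r) => y y0; case: (clampP (w + y) k0) => -[? ->];
    case: (clampP (w + r) k0) => -[? ->]; lra.
Qed.

Lemma continuous_clamp kappa : 0 < kappa -> continuous (clamp kappa).
Proof.
move=> k0 a; apply/cvgrPdist_lt => e e0.
apply: (filterS _ (nbhsx_ballx a e e0)) => b; exact: le_lt_trans (clamp_dist _ _ k0).
Qed.

End clamp.

(** * The finite-dimensional truncated system *)

Section clamped_system.
Context {R : realType} {N : nat}.
Notation vec := 'rV[R]_N.
Variables (A : 'M[R]_N) (s F : 'I_N -> R) (kappa : R).
Hypotheses (kappa0 : 0 < kappa) (s0 : forall i, 0 < s i).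
Implicit Types (e u v w : vec).

Definition mulA w i : R := \sum_j A i j * w ord0 j.

Definition quad e : R := \sum_i e ord0 i * mulA e i.

Hypothesis A0 : forall e, e != 0 -> 0 < quad e.

Definition snorm2 e : R := \sum_i s i * e ord0 i ^+ 2.

Definition resid w i : R := (F i - mulA w i) / s i.

Definition proj_step t w : vec := \row_i clamp kappa (w ord0 i + t * resid w i).

Lemma mulAB u v i : mulA (u - v) i = mulA u i - mulA v i.
Proof. by rewrite /mulA -sumrB; apply: eq_bigr => j _; rewrite !mxE mulrBr. Qed.

Lemma mulAZ (c : R) u i : mulA (c *: u) i = c * mulA u i.
Proof. by rewrite /mulA mulr_sumr; apply: eq_bigr => j _; rewrite !mxE mulrCA. Qed.

Lemma quadZ (c : R) e : quad (c *: e) = c ^+ 2 * quad e.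
Proof.
by rewrite /quad mulr_sumr; apply: eq_bigr => i _; rewrite mulAZ !mxE; ring.
Qed.

Lemma Ck0_mulA i : Ck 0 (fun w : vec => mulA w i).
Proof.
rewrite (_ : (fun _ => _) = \sum_j A i j *: (fun w : vec => w ord0 j)).
  by apply: Ck_sum => j _; apply: CkZ; exact: Ck_coord.
by apply/funext => w; rewrite fct_sumE.
Qed.

Lemma continuous_quad : continuous quad.
Proof.
rewrite (_ : quad = \sum_i (fun w : vec => w ord0 i) * (fun w : vec => mulA w i)).
  apply: (@Ck_continuous _ _ 0); apply: Ck_sum => i _.
  by apply: CkM; [exact: Ck_coord|exact: Ck0_mulA].
by apply/funext => w; rewrite fct_sumE.
Qed.

(** The squared [S]-norm of S^-1 A e, the coefficient of t^2 when the step is expanded. *)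
Definition quad2 e : R := \sum_i mulA e i ^+ 2 / s i.

Lemma quad2Z (c : R) e : quad2 (c *: e) = c ^+ 2 * quad2 e.
Proof.
by rewrite /quad2 mulr_sumr; apply: eq_bigr => i _; rewrite mulAZ exprMn mulrA.
Qed.

Lemma continuous_quad2 : continuous quad2.
Proof.
rewrite (_ : quad2 = \sum_i (s i)^-1 *: ((fun w : vec => mulA w i) ^+ 2)).
  apply: (@Ck_continuous _ _ 0); apply: Ck_sum => i _.
  by apply: CkZ; apply: Ck_exp; exact: Ck0_mulA.
by apply/funext => w; rewrite fct_sumE; apply: eq_bigr => i _; rewrite exprfctE mulrC.
Qed.

(** Both forms are homogeneous of degree 2, so it suffices to compare them on the compact unit
    sphere, where [quad] has a positive minimum and [quad2] a maximum. *)
Lemma small_step : exists2 t : R, 0 < t & forall e, e != 0 -> t * quad2 e < 2 * quad e.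
Proof.
pose S : set vec := [set e | `|e| = 1].
have toS e : e != 0 -> S (`|e|^-1 *: e).
  by move=> e0; rewrite /S /= normrZ normfV normr_id mulVf// normr_eq0.
(* For [N = 0] the sphere is empty, and so is the set of nonzero [e]. *)
have [Sn0|Sn0] := pselect (S !=set0); last first.
  by exists 1 => // e /toS Se; exfalso; apply: Sn0; exists (`|e|^-1 *: e).
have cS : compact S.
  apply: bounded_closed_compact.
    by exists 1; split => // M M1 e /= ->; exact: ltW.
  apply: (@closed_comp _ _ (fun e : vec => `|e|) [set 1]); last exact: closed_eq.
  by move=> e _; exact: norm_continuous.
have [e1 Se1 min1] := EVT_min_rV Sn0 cS (continuous_subspaceT continuous_quad).
have [e2 Se2 max2] := EVT_max_rV Sn0 cS (continuous_subspaceT continuous_quad2).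
have q1 : 0 < quad e1.
  by apply: A0; rewrite -normr_eq0; move: Se1; rewrite inE /S /= => ->; exact: oner_neq0.
have P0 e : 0 <= quad2 e.
  by apply: sumr_ge0 => i _; rewrite divr_ge0 ?sqr_ge0// ltW.
have M1 : 0 < quad2 e2 + 1 by rewrite ltr_wpDl.
(* Minimum over maximum, so [t * quad2 f] is at most [quad e1], hence below [2 * quad f]; the 1
   keeps the denominator positive. *)
exists (quad e1 / (quad2 e2 + 1)); first by rewrite divr_gt0.
move=> e e0; have n0 : 0 < `|e| by rewrite normr_gt0.
have eE : e = `|e| *: (`|e|^-1 *: e) by rewrite scalerA mulfV ?scale1r// gt_eqF.
set f := `|e|^-1 *: e in eE; have Sf : f \in S by rewrite inE; exact: toS.
have E2 : quad2 e = `|e| ^+ 2 * quad2 f.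
  by rewrite {1}eE quad2Z.
have E1 : quad e = `|e| ^+ 2 * quad f by rewrite {1}eE quadZ.
rewrite E1 E2 mulrCA [ltRHS]mulrCA ltr_pM2l ?exprn_gt0//.
have := min1 f Sf; have := max2 f Sf => p2 p1.
have h : quad e1 / (quad2 e2 + 1) * quad2 f <= quad e1.
  rewrite mulrAC ler_pdivrMr// ler_wpM2l ?(ltW q1)//.
  by rewrite (le_trans p2)// lerDl.
by rewrite (le_lt_trans h)//; lra.
Qed.

(** [clamp] is 1-Lipschitz in each coordinate, so it may be dropped. Expanding the square, the
    division by [s i] in [resid] cancels the weight in the cross term and leaves [quad e]. *)
Lemma proj_step_contract t : 0 < t -> (forall e, e != 0 -> t * quad2 e < 2 * quad e) ->
  forall w z, w != z -> snorm2 (proj_step t w - proj_step t z) < snorm2 (w - z).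
Proof.
move=> t0 small w z wz; set e := w - z.
have e0 : e != 0 by rewrite subr_eq0.
apply: (@le_lt_trans _ _ (snorm2 (\row_i (e ord0 i - t * (mulA e i / s i))))).
  apply: ler_sum => i _; rewrite ler_wpM2l ?(ltW (s0 i))// !mxE.
  rewrite -[leLHS]real_normK ?num_real// -[leRHS]real_normK ?num_real//.
  rewrite ler_pXn2r ?nnegrE// (le_trans (clamp_dist _ _ kappa0))//.
  rewrite /resid mulAB; set X := _ - _; set Y := _ - _ * _.
  suff -> : X = Y by [].
  by rewrite /X /Y; ring.
have -> : snorm2 (\row_i (e ord0 i - t * (mulA e i / s i))) =
    snorm2 e - t * (2 * quad e - t * quad2 e).
  rewrite /snorm2 /quad /quad2 !mulr_sumr -sumrB mulr_sumr -sumrB.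
  apply: eq_bigr => i _; rewrite mxE; field; exact: lt0r_neq0.
by rewrite gtrBl mulr_gt0// subr_gt0 small.
Qed.

Lemma clamped_system_ex : exists u : 'I_N -> R, forall i,
  \sum_j A i j * clamp kappa (u j) + s i * (u i - clamp kappa (u i)) = F i.
Proof.
have [t t0 small] := small_step.
pose B : set vec := closed_box 0 (const_mx kappa).
have stepB w : B (proj_step t w) by move=> i; rewrite !mxE clamp_itv.
pose g w := snorm2 (w - proj_step t w).
have cg : continuous g.
  have cc i : Ck 0 (fun w : vec => clamp kappa (w ord0 i + t * resid w i)).
    pose l := (fun w : vec => w ord0 i) +
      t *: ((s i)^-1 *: (cst (F i) + (-1) *: (fun w : vec => mulA w i))).
    have Cl : Ck 0 l.
      apply: CkD; [exact: Ck_coord|apply: CkZ; apply: CkZ; apply: CkD; [exact: Ck_cst|]].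
      by apply: CkZ; exact: Ck0_mulA.
    have lE w : w ord0 i + t * resid w i = l w.
      by rewrite /l /resid !fctE -![_ *: _]/(_ * _); ring.
    rewrite (_ : (fun w : vec => _) = clamp kappa \o l); last first.
      by apply/funext => w /=; rewrite lE.
    split=> // w; apply: (@continuous_comp _ _ _ l); first exact: (Ck_continuous Cl).
    exact: continuous_clamp.
  rewrite (_ : g = \sum_i s i *: (((fun w : vec => w ord0 i) +
      (-1) *: (fun w : vec => clamp kappa (w ord0 i + t * resid w i))) ^+ 2)).
    apply: (@Ck_continuous _ _ 0); apply: Ck_sum => i _; apply: CkZ; apply: Ck_exp.
    by apply: CkD; [exact: Ck_coord|exact: CkZ].
  apply/funext => w; rewrite fct_sumE; apply: eq_bigr => i _.
  by rewrite !mxE !fctE -![_ *: _]/(_ * _) mulN1r.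
have [w wB wmin] : exists2 w, w \in B & forall z, z \in B -> g w <= g z.
  apply: EVT_min_rV; last exact: continuous_subspaceT.
    by exists (proj_step t 0).
  exact: compact_closed_box.
(* Otherwise [proj_step t w], again a point of the box, would have a strictly smaller displacement
   than [w]. *)
have wE : w = proj_step t w.
  apply/eqP; apply: contrapT => /negP wne.
  have := proj_step_contract t0 small wne; rewrite ltNge.
  by rewrite wmin// inE.
(* Once the truncation of this [u] is known to be [w], the term s (u - w) equals F - A w by
   definition of [resid]. *)
exists (fun i => w ord0 i + resid w i) => i.
have cE j : clamp kappa (w ord0 j + resid w j) = w ord0 j.
  by apply: (clamp_scale kappa0 t0); move/rowP/(_ j) : wE; rewrite mxE => <-.
rewrite (eq_bigr (fun j => A i j * w ord0 j)) => [|j _]; last by rewrite cE.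
rewrite cE /resid -/(mulA w i); field; exact: lt0r_neq0.
Qed.

Lemma clamped_system_unique (u v : 'I_N -> R) :
  (forall i, \sum_j A i j * clamp kappa (u j) + s i * (u i - clamp kappa (u i)) = F i) ->
  (forall i, \sum_j A i j * clamp kappa (v j) + s i * (v i - clamp kappa (v i)) = F i) ->
  u =1 v.
Proof.
move=> uE vE; pose cu : vec := \row_i clamp kappa (u i); pose cv : vec := \row_i clamp kappa (v i).
have E (z : 'I_N -> R) i : \sum_j A i j * clamp kappa (z j) = mulA (\row_i clamp kappa (z i)) i.
  by apply: eq_bigr => j _; rewrite mxE.
have D i : mulA (cu - cv) i = - (s i * ((u i - clamp kappa (u i)) - (v i - clamp kappa (v i)))).
  by rewrite mulAB -!E; have := uE i; have := vE i; rewrite mulrBr; lra.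
(* By [D] and monotonicity the quadratic form at [cu - cv] is at most 0, against positive
   definiteness. *)
have cuv : cu = cv.
  apply/eqP; rewrite -subr_eq0; apply: contrapT => /negP/A0; rewrite ltNge; apply/negP; rewrite negbK.
  rewrite /quad -oppr_ge0 -sumrN; apply: sumr_ge0 => i _.
  rewrite D mulrN opprK !mxE mulrCA mulr_ge0 ?(ltW (s0 i))//.
  exact: clamp_monotone.
(* With equal truncations the left side of [D] is 0, and [s i > 0] forces [u i = v i]. *)
move=> i; have := D i; rewrite cuv subrr.
have -> : mulA 0 i = 0 by apply: big1 => j _; rewrite mxE mulr0.
have /rowP/(_ i) := cuv; rewrite !mxE => -> /eqP.
rewrite eq_sym oppr_eq0 mulf_eq0 (gt_eqF (s0 i)) /= => /eqP; lra.
Qed.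

End clamped_system.

(** * The finite element space *)

Section finite_element_space.
Context {R : realType} {d m k : nat}.
Notation vec := 'rV[R]_d.
Notation mu := (@lebesgue_rV R d).
Variables (Om : set vec) (K : 'I_m -> cell R d).
Hypotheses (oOm : open Om) (bOm : bounded_set Om).
Implicit Types (v w : vec -> R).

Lemma VP_lin (c : R) v w : VP Om K k v -> VP Om K k w -> VP Om K k (c *: v + w).
Proof.
move=> [cv v0 pv Hv] [cw w0 pw Hw]; split.
- apply/subspace_continuousP => x xO.
  have {}cv := (subspace_continuousP _ _).1 cv x xO.
  have {}cw := (subspace_continuousP _ _).1 cw x xO.
  by apply: cvgD => //; apply: cvgZ => //; exact: cvg_cst.
- by move=> x xO; rewrite !fctE v0// w0// scaler0 addr0.
- exact: (piecewise_poly_lin c pv pw).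
- exact: H10_lin.
Qed.

Lemma VP_0 : VP Om K k 0.
Proof.
split=> // [|i|]; last exact: H10_0.
  by apply: continuous_subspaceT; exact: cst_continuous.
by exists 0 => //; exact: local_space0.
Qed.

(** By continuity [v] is nonzero on an open neighbourhood of [x], which has positive measure. *)
Lemma VP_ip_gt0 v x : VP Om K k v -> Om x -> v x != 0 -> 0 < L2_ip Om v v.
Proof.
move=> [cv _ _ [[Lv _] _]] Ox vx; rewrite lt_neqAle ip_ge0 andbT eq_sym.
apply/eqP => /(ip_eq0 (measurable_open_rV oOm) Lv)[A [mA A0 OA]].
have cvx : v y @[y --> x] --> v x.
  have := continuous_subspaceW (@subset_closure _ Om) cv.
  by rewrite (continuous_open_subspace _ oOm) => h; apply: h; rewrite inE.
have : nbhs x (Om `&` [set y | v y != 0]).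
  apply: filterI; first exact: open_nbhs_nbhs.
  by apply: (cvx [set t | t != 0]); apply: open_nbhs_nbhs; split => //; exact: open_neq.
rewrite nbhsE => -[V [oV Vx] VO].
have := open_lebesgue_rV_gt0 oV (ex_intro _ x Vx); rewrite ltNge => /negP; apply.
rewrite -A0; apply: le_measure; rewrite ?inE//; first exact: measurable_open_rV.
move=> y /VO[Oy vy]; apply: OA => /= h; by move/eqP: vy; apply; exact: h.
Qed.

(** [G] is linear on [P] only, so membership of the partial sums travels with the induction. *)
Lemma linear_on_sum (P : set (vec -> R)) (G : (vec -> R) -> R) N
    (phi : 'I_N -> vec -> R) (c : 'I_N -> R) :
  P 0 -> (forall c v w, P v -> P w -> P (c *: v + w)) ->
  (forall c v w, P v -> P w -> G (c *: v + w) = c * G v + G w) ->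
  (forall i, P (phi i)) ->
  P (\sum_i c i *: phi i) /\ G (\sum_i c i *: phi i) = \sum_i c i * G (phi i).
Proof.
move=> P0 Plin Glin Pphi.
have G0 : G 0 = 0.
  by have := Glin 1 0 0 P0 P0; rewrite scaler0 addr0 mul1r; lra.
elim: (index_enum _) => [|i r [ihP ihG]]; first by rewrite !big_nil.
by rewrite !big_cons; split; [exact: Plin|rewrite Glin// ihG].
Qed.

End finite_element_space.

(** * Reduction of the discrete problem to nodal coordinates *)

Theorem corollary3p6 (R : realType) (d : nat) (hd : d = 2%N \/ d = 3%N)
  (Om : set 'rV[R]_d) (hOm : polyhedral_lipschitz_domain Om)
  (f : ('rV[R]_d -> R) -> R) (hf : Hm1 Om f)
  (D : 'rV[R]_d -> 'M[R]_d) (d0 : R) (hd0 : 0 < d0)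
  (hD : diffusion_tensor Om D d0)
  (b : 'rV[R]_d -> 'rV[R]_d) (hb : convection_field Om b)
  (mu kappa : R) (hmu : 0 < mu) (hkappa : 0 < kappa)
  (m : nat) (K : 'I_m -> cell R d) (hK : conforming_partition Om K)
  (sigma : R) (hsigma : shape_regular K sigma)
  (rho : R) (hrho : quasi_uniform K rho)
  (hbK : facet_regular K b)
  (k : nat) (hk : (1 <= k)%N)
  (N : nat) (x : 'I_N -> 'rV[R]_d) (hx : is_node_enumeration Om K k x)
  (phi : 'I_N -> 'rV[R]_d -> R) (hphi : is_lagrange_basis Om K k x phi)
  (h : 'rV[R]_d -> R) (hh : is_mesh_function Om K h)
  (gamma alpha : R) (hgamma : 0 <= gamma) (halpha : 0 < alpha) :
  exists! u, VP Om K k u /\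
    forall v, VP Om K k v ->
      form_aJ Om K D b mu gamma (pos_part x phi kappa u) v +
      form_s K D b mu x h alpha (neg_part x phi kappa u) v = f v.
Proof.
have dgt0 : (0 < d)%N by case: hd => ->.
have [oOm _ bOm _ _] := hOm; have [uK _ _ _] := hK.
have [Vphi phix Vspan] := hphi; have [flin _] := hf.
have Vlin := @VP_lin R d m k Om K oOm bOm; have V0 := @VP_0 R d m k Om K oOm bOm.
have VH v : VP Om K k v -> H1 Om v by move=> [_ _ _ []].
have Vpw v : VP Om K k v -> piecewise_poly (k := k) K v by case.
pose aJ := form_aJ Om K D b mu gamma.
have lin2 (c y z y' z' : R) : c * y + y' + (c * z + z') = c * (y + z) + (y' + z').
  by ring.
have aJl v c w w' : VP Om K k v -> VP Om K k w -> VP Om K k w' ->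
    aJ (c *: w + w') v = c * aJ w v + aJ w' v.
  move=> Vv Vw Vw'; rewrite /aJ /form_aJ.
  rewrite (form_a_linl oOm bOm mu hD hb c (VH _ Vw) (VH _ Vw') (VH _ Vv)).
  rewrite (form_J_linl dgt0 uK b gamma c (Vpw _ Vw) (Vpw _ Vw') (Vpw _ Vv)).
  exact: lin2.
have aJr v c w w' : VP Om K k v -> VP Om K k w -> VP Om K k w' ->
    aJ v (c *: w + w') = c * aJ v w + aJ v w'.
  (* Symmetry of the jump form moves the combination to its first argument; the form [a] has its own
     right linearity. *)
  move=> Vv Vw Vw'; rewrite /aJ /form_aJ !(form_JC _ _ _ v).
  rewrite (form_a_linr oOm bOm mu hD hb c (VH _ Vv) (VH _ Vw) (VH _ Vw')).
  rewrite (form_J_linl dgt0 uK b gamma c (Vpw _ Vw) (Vpw _ Vw') (Vpw _ Vv)).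
  exact: lin2.
have Vsum c : VP Om K k (\sum_i c i *: phi i).
  (* Only membership is wanted, so the functional is taken to be 0. *)
  by have [] := @linear_on_sum _ _ (VP Om K k) (fun=> 0) _ phi c V0 Vlin _ Vphi;
    first by move=> *; rewrite mulr0 addr0.
have coord c j : (\sum_i c i *: phi i) (x j) = c j.
  rewrite fct_sumE (bigD1 j)//= big1 ?addr0 => [|i ij].
    by rewrite fctE phix eqxx -[_ *: _]/(_ * _) mulr1.
  by rewrite fctE phix (negbTE ij) scaler0.
have spanE v : VP Om K k v -> v = \sum_i v (x i) *: phi i.
  by move=> /Vspan[c ->]; apply: eq_bigr => i _; rewrite coord.
have xOm i : Om (x i) /\ exists j, carrier (K j) (x i).
  have : internal_nodes Om K k (x i) by have [_ <-] := hx; exists i.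
  by move=> [Oxi [j [y [yK _] yE]]]; split => //; exists j, y.
have hpos i : 0 < h (x i).
  by have [_ [j xj]] := xOm i; exact: mesh_function_gt0 hh j _ xj.
pose s i := alpha *
  (fine (Linf_norm (node_patch K (x i)) (fun y => enorm (D y))) * h (x i) ^+ (d - 2)
   + fine (Linf_norm (node_patch K (x i)) (fun y => enorm (b y))) * h (x i) ^+ (d - 1)
   + mu * h (x i) ^+ d).
have s0 i : 0 < s i.
  have h0 := ltW (hpos i); have hn n : 0 <= h (x i) ^+ n by exact: exprn_ge0.
  rewrite mulr_gt0// ltr_wpDl ?mulr_gt0 ?exprn_gt0//.
  by rewrite addr_ge0// mulr_ge0// fine_ge0// Lnorm_ge0.
have sE v w : form_s K D b mu x h alpha v w = \sum_i s i * v (x i) * w (x i).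
  by rewrite /form_s mulr_sumr; apply: eq_bigr => i _; rewrite /s !mulrA.
(* Rows are indexed by test functions, columns by trial functions; the order matters since [aJ] need
   not be symmetric. *)
pose A : 'M[R]_N := \matrix_(i, j) aJ (phi j) (phi i).
have AE c i : aJ (\sum_j c j *: phi j) (phi i) = \sum_j A i j * c j.
  have [_ ->] := @linear_on_sum _ _ (VP Om K k) (aJ^~ (phi i)) _ phi c V0 Vlin
    (fun c w w' => aJl (phi i) c w w' (Vphi i)) Vphi.
  by apply: eq_bigr => j _; rewrite mxE mulrC.
have A0 e : e != 0 -> 0 < quad A e.
  move=> e0; pose v := \sum_i e ord0 i *: phi i; have Vv : VP Om K k v := Vsum _.
  have -> : quad A e = aJ v v.
    have [_ ->] := @linear_on_sum _ _ (VP Om K k) (aJ v) _ phi (e ord0) V0 Vlin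
      (fun c w w' => aJr v c w w' Vv) Vphi.
    by apply: eq_bigr => i _; rewrite AE.
  have [i ei] : exists i, e ord0 i != 0.
    apply: contrapT => ne; move/eqP: e0; apply; apply/rowP => j; rewrite mxE.
    by apply/eqP; apply: contrapT => /negP ej; apply: ne; exists j.
  have [Oxi _] := xOm i.
  (* The jumps are dropped; the reaction term is positive because [v] is nonzero at the node [x i],
     which lies in [Om]. *)
  rewrite ltr_wpDr ?form_J_ge0//; have [_ _ _ Hv] := Vv.
  apply: lt_le_trans (form_a_coercive oOm bOm mu hD hb (ltW hd0) Hv).
  by rewrite mulr_gt0//; apply: (VP_ip_gt0 oOm Vv Oxi); rewrite /v coord.
have posE v : pos_part x phi kappa v = \sum_i clamp kappa (v (x i)) *: phi i by [].
have eqnP u : VP Om K k u -> (forall v, VP Om K k v ->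
      aJ (pos_part x phi kappa u) v +
      form_s K D b mu x h alpha (neg_part x phi kappa u) v = f v) <->
    forall i, \sum_j A i j * clamp kappa (u (x j)) +
      s i * (u (x i) - clamp kappa (u (x i))) = f (phi i).
  move=> Vu; pose r v := aJ (pos_part x phi kappa u) v +
      form_s K D b mu x h alpha (neg_part x phi kappa u) v.
  have rE i : r (phi i) = \sum_j A i j * clamp kappa (u (x j)) +
      s i * (u (x i) - clamp kappa (u (x i))).
    rewrite /r posE AE; congr (_ + _); rewrite sE (bigD1 i)//= big1 ?addr0 => [|j ji].
      by rewrite phix eqxx mulr1 /neg_part posE !fctE coord.
    by rewrite phix eq_sym (negbTE ji) mulr0.
  (* One direction tests with the basis functions; the other expands [v] in the basis and uses
     linearity of both sides in the test function. *)
  split=> [H i|H v Vv]; first exact: (etrans (esym (rE i)) (H _ (Vphi i))).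
  have rlin c w w' : VP Om K k w -> VP Om K k w' -> r (c *: w + w') = c * r w + r w'.
    move=> Vw Vw'; have al := aJr (pos_part x phi kappa u) c w w' (Vsum _) Vw Vw'.
    have sl : form_s K D b mu x h alpha (neg_part x phi kappa u) (c *: w + w') =
        c * form_s K D b mu x h alpha (neg_part x phi kappa u) w +
        form_s K D b mu x h alpha (neg_part x phi kappa u) w'.
      rewrite !sE; apply: sum_lin => i.
      by rewrite !fctE -[_ *: _]/(_ * _); ring.
    exact: (etrans (congr2 +%R al sl) (lin2 _ _ _ _ _)).
  have [_ E1] := @linear_on_sum _ _ (VP Om K k) r _ phi (fun i => v (x i)) V0 Vlin rlin Vphi.
  have [_ E2] := @linear_on_sum _ _ (VP Om K k) f _ phi (fun i => v (x i)) V0 Vlin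
    (fun c w w' '(And4 _ _ _ Hw) '(And4 _ _ _ Hw') => flin c w w' Hw Hw') Vphi.
  suff : r v = f v by [].
  rewrite (spanE v Vv) E1 E2; apply: eq_bigr => i _; congr (_ * _).
  exact: (etrans (rE i) (H i)).
have [u uE] := clamped_system_ex (fun i => f (phi i)) hkappa s0 A0.
exists (\sum_i u i *: phi i); split=> [|w [Vw wE]].
  split; first exact: Vsum.
  by apply/(eqnP _ (Vsum u)) => i; rewrite coord -uE; congr (_ + _); apply: eq_bigr => j _; rewrite coord.
have wE' := (eqnP _ Vw).1 wE.
(* A function of the space is determined by its nodal values, so uniqueness for the system
   suffices. *)
rewrite (spanE w Vw); apply: eq_bigr => i _; congr (_ *: _).
exact: (clamped_system_unique hkappa s0 A0 uE wE').
Qed.
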